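(* Suppose that the parameters $p,q,s,t,v$ satisfy $0<q\le p<\infty$, $0<t\le s<\infty$, $0<v\le1$, $p<s$, and $v<q<t$. Assume that $\{Q_j\}_{j=1}^\infty\subset\mathcal{Q}(\mathbb{R}^n)$, $\{a_j\}_{j=1}^\infty\subset\mathrm{W}\mathcal{M}^s_t(\mathbb{R}^n)$ and $\{\lambda_j\}_{j=1}^\infty\subset[0,\infty)$ fulfill $$\|a_j\|_{\mathrm{W}\mathcal{M}^s_t}\le|Q_j|^{\frac1s},\quad\mathrm{supp}(a_j)\subset Q_j\quad(j\in\mathbb{N}),\qquad\left\|\left(\sum_{j=1}^\infty(\lambda_j\chi_{Q_j})^v\right)^{\frac1v}\right\|_{\mathrm{W}\mathcal{M}^p_q}<\infty.$$ Then $f=\sum_{j=1}^\infty\lambda_ja_j$ converges a.e. and satisfies $$\|f\|_{\mathrm{W}\mathcal{M}^p_q}\le C\left\|\left(\sum_{j=1}^\infty(\lambda_j\chi_{Q_j})^v\right)^{\frac1v}\right\|_{\mathrm{W}\mathcal{M}^p_q},$$ where $C>0$ depends only on $n,p,q,s,t,v$.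
   Context: $L^0(\mathbb{R}^n)$ is the set of all measurable functions on $\mathbb{R}^n$, $\mathcal{Q}(\mathbb{R}^n)$ is the family of all cubes in $\mathbb{R}^n$ with sides parallel to the coordinate axes, $|E|$ is Lebesgue measure, and $\chi_E$ is the indicator function of $E$. For $0<q\le p<\infty$, the Morrey quasi-norm is $\|f\|_{\mathcal{M}^p_q}=\sup_{Q\in\mathcal{Q}(\mathbb{R}^n)}|Q|^{\frac1p-\frac1q}\|f\chi_Q\|_{L^q}$, and the weak Morrey space $\mathrm{W}\mathcal{M}^p_q(\mathbb{R}^n)$ is the set of $f\in L^0(\mathbb{R}^n)$ with $\|f\|_{\mathrm{W}\mathcal{M}^p_q}=\sup_{\lambda>0}\lambda\|\chi_{\{x\in\mathbb{R}^n:|f(x)|>\lambda\}}\|_{\mathcal{M}^p_q}<\infty$. *)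

(* Defs.v *)
From HB Require Import structures.
From mathcomp Require Import all_boot all_order all_algebra.
From mathcomp Require Import all_classical all_reals all_analysis.
From mathcomp Require Export complex.

Set Implicit Arguments.
Unset Strict Implicit.
Unset Printing Implicit Defensive.
Import Order.TTheory GRing.Theory Num.Theory.
Import numFieldNormedType.Exports.

Local Open Scope classical_set_scope.
Local Open Scope ring_scope.

(* The Borel Lebesgue measure on n.-tuple R is the n-fold product of
   lebesgue_measure, built by induction on n by transporting the binary product
   along (x, t) |-> x :: t.  The case n = 0 is the unit mass on the one point. *)
Section borel_lebesgue.
Context (R : realType).

Definition consT (n : nat) (z : R * n.-tuple R) : n.+1.-tuple R :=
  [the n.+1.-tuple R of z.1 :: z.2].

Lemma measurable_consT n :
  measurable_fun [set: measurableTypeR R * n.-tuple (measurableTypeR R)]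
    (@consT n : measurableTypeR R * n.-tuple (measurableTypeR R) ->
                n.+1.-tuple (measurableTypeR R)).
Proof.
apply: (@measurable_cons _ _ _ (measurableTypeR R) fst n snd);
  [exact: measurable_fst | exact: measurable_snd].
Qed.

Section step.
Context (n : nat).
Variable m :
  {sigma_finite_measure set (n.-tuple (measurableTypeR R)) -> \bar R}.

Definition borel_lebesgue_step
    : set (n.+1.-tuple (measurableTypeR R)) -> \bar R :=
  pushforward (product_measure1 (@lebesgue_measure R) m) (@consT n).

HB.instance Definition _ := Measure.copy borel_lebesgue_step
  (measure_function_pushforward__canonical__measure_function_Measure
     (product_measure1 (@lebesgue_measure R) m) (@measurable_consT n)).

Let borel_lebesgue_step_sigma_finite : sigma_finite setT borel_lebesgue_step.
Proof.
have /sigma_finiteP[F [FT ndF Foo]] := sigma_finiteT (@lebesgue_measure R).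
have /sigma_finiteP[G [GT ndG Goo]] := sigma_finiteT m.
pose uncons (t : n.+1.-tuple (measurableTypeR R)) :
  measurableTypeR R * n.-tuple (measurableTypeR R) :=
  (thead t, [tuple of behead t]).
have munc : measurable_fun setT uncons.
  apply/measurable_fun_pair; first exact: (measurable_tnth ord0).
  exact: measurable_behead.
exists (fun i => uncons @^-1` (F i `*` G i)).
  rewrite -preimage_bigcup -[LHS](preimage_setT uncons); congr (_ @^-1` _).
  rewrite -setXTT FT GT predeqE => -[x y]; split=> [[[i _ Fx] [j _ Gy]]|].
    exists (maxn i j) => //; split=> /=.
    - by have /subsetPset := ndF _ _ (leq_maxl i j); exact.
    - by have /subsetPset := ndG _ _ (leq_maxr i j); exact.
  by move=> [i _ [Fx Gy]]; split; exists i.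
move=> i; have [mF Fi] := Foo i; have [mG Gi] := Goo i; split.
  by rewrite -[X in measurable X]setTI; apply: munc => //; exact: measurableX.
rewrite /borel_lebesgue_step /pushforward -comp_preimage.
have -> : uncons \o @consT n = id.
  apply/funext => -[x t]; rewrite /uncons/= theadE; congr pair.
  exact/val_inj.
rewrite [ltLHS](product_measure1E _ _ mF mG).
by rewrite lte_mul_pinfty// ge0_fin_numE.
Qed.

HB.instance Definition _ := @Measure_isSigmaFinite.Build _ _ _
  borel_lebesgue_step borel_lebesgue_step_sigma_finite.

End step.

Fixpoint borel_lebesgue (n : nat) :
    {sigma_finite_measure set (n.-tuple (measurableTypeR R)) -> \bar R} :=
  match n with
  | 0 => \d_([tuple] : 0.-tuple (measurableTypeR R))
  | m.+1 => borel_lebesgue_step (borel_lebesgue m)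
  end.

End borel_lebesgue.

(* R^n with its Lebesgue sigma-algebra (the completion of the Borel one) and the
   Lebesgue measure on it. *)
Definition Rn (R : realType) (n : nat) : measurableType _ :=
  caratheodory_type (R := R)
    ((borel_lebesgue R n :
        {measure set (n.-tuple (measurableTypeR R)) -> \bar R})^*)%mu.

Definition leb (R : realType) (n : nat) : {measure set (Rn R n) -> \bar R} :=
  @completed_measure_extension _ _ R (borel_lebesgue R n).

Section weak_morrey.
Context (R : realType) (n : nat).
Implicit Types (p q : R) (F : Rn R n -> \bar R) (f : Rn R n -> R[i]).

(* Each face of the cube may or may not belong to it: bl and br choose, for each
   coordinate, whether the left and right endpoints are included. *)
Definition cubes : set (set (Rn R n)) :=
  [set Q | exists (c : 'I_n -> R) (l : R) (bl br : 'I_n -> bool), 0 < l /\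
    Q = [set x | forall i, tnth x i \in
                 Interval (BSide (bl i) (c i)) (BSide (br i) (c i + l))]].

(* The quasi-norms are defined on \bar R-valued functions, since the series of
   functions they are applied to may take the value +oo; a complex-valued f is
   measured through its modulus. *)
Definition morrey_norm p q F : \bar R :=
  ereal_sup [set (leb R n Q `^ (p^-1 - q^-1) *
    Lnorm (leb R n) q%:E (fun x => F x * (\1_Q x)%:E))%E | Q in cubes].

Definition weak_morrey_norm p q F : \bar R :=
  ereal_sup [set (r%:E *
    morrey_norm p q (EFin \o \1_[set x | (r%:E < `|F x|)%E]))%E
    | r in [set r : R | 0 < r]].

Definition modulus f : Rn R n -> \bar R :=
  fun x => (ComplexField.Normc.normc (f x))%:E.

Definition L0 f : Prop :=
  measurable_fun setT (fun x => complex.Re (f x)) /\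
  measurable_fun setT (fun x => complex.Im (f x)).

Definition weak_morrey p q : set (Rn R n -> R[i]) :=
  [set f | L0 f /\ (weak_morrey_norm p q (modulus f) < +oo)%E].

(* Tuples carry no topology in the library: the closure is taken in 'rV[R]_n. *)
Definition supp f : set (Rn R n) :=
  let row x : 'rV[R]_n := \row_i tnth x i in
  [set x | closure [set row y | y in [set y | f y != 0]] (row x)].

End weak_morrey.

(* Main.v *)
Require Import Defs.
From mathcomp Require Import all_boot all_order all_algebra.
From mathcomp Require Import all_classical all_reals all_analysis.
From mathcomp Require Import measurable_realfun ring lra.

(* As [v <= 1], [|f|^v <= H := sum_j lam_j^v |a_j|^v] and the [v]-th power of the
   majorant is [sum_j lam_j^v 1_{Q_j}], so dividing all the exponents by [v] one may
   assume [v = 1] and [q > 1].  By Kolmogorov's inequality it then suffices to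
   bound [int_E H] by [C N |E|^(1-1/q) |Q|^(1/q-1/p)] for [E] inside a cube [Q],
   [N] being the norm of the majorant.  The cubes [Q_j] meeting [Q] and not larger
   than [Q] are sorted by the density of [E] in [Q_j]: the atom bound
   [int_E a_j <= C |Q_j| (|E n Q_j| / |Q_j|)^(1-1/t)] and Vitali's covering lemma
   yield a geometric series, convergent because [q < t].  The larger ones are sorted
   by size, where [int_E a_j <= C |Q_j|^(1/s) |Q|^(1/t-1/s) |E|^(1-1/t)] yields a
   geometric series, convergent because [p < s].  Taking for [E] a superlevel set
   of [H] concludes. *)

Set Implicit Arguments.
Unset Strict Implicit.
Unset Printing Implicit Defensive.
Import Order.TTheory GRing.Theory Num.Theory.
Import numFieldNormedType.Exports.

Local Open Scope classical_set_scope.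
Local Open Scope ring_scope.

(** * Kolmogorov's inequality *)

(** A quasi-norm loses a factor at each addition, so the terms cannot be summed in norm; [int_E H]
    is additive in [H], which is why everything is tested on sets [E], and Kolmogorov's inequality
    then requires exponents above [1]. The weights are controlled only through [sum w_j |Q_j|], the
    integral of [sum w_j 1_{Q_j}]: up to a constant it is at most [N |U|^(1-1/q) |B|^(1/q-1/p)] when
    the [Q_j] lie in a subset [U] of a cube [B]. If [E] has density about [2^-k] in [Q_j], the atom
    costs [2^(-k(1-1/t)) |Q_j|], whereas Vitali allows [|U|] to be of order [2^k |E|]; the product
    decays in [k] exactly when [q < t]. Cubes larger than [Q] leave every fixed multiple of [Q]: for
    sides about [2^k l], the box [B] costs [|B|^(1-1/p)] and the atom, relative to [|Q_j|], gains
    [|B|^(1/s-1)], so that [p < s] decides. All this is done on finite partial sums with constants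
    free of the number of terms. *)

Lemma dyadic_scale (R : realType) (y : R) :
  1 < y -> exists k : nat, 2 ^+ k < y /\ y <= 2 ^+ k.+1.
Proof.
move=> y1.
have ex : exists k, y <= 2 ^+ k.
  by exists (Num.bound y); apply/ltW/upper_nthrootP.
case: (ex_minnP ex) => -[|k]; first by rewrite expr0 leNgt y1.
move=> yk mink; exists k; split => //; rewrite ltNge; apply/negP => /mink.
by rewrite ltnn.
Qed.

Lemma powR1B (R : realType) (x a : R) : 0 < x -> x `^ (1 - a) = x * x `^ (- a).
Proof.
by move=> x0; rewrite powRD ?powRr1 ?ltW//; apply/implyP => _; rewrite gt_eqF.
Qed.

Lemma measurable_superlevel d (T : measurableType d) (R : realType)
    (h : T -> R) (r : R) :
  measurable_fun setT h -> measurable [set x | r < h x].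
Proof.
move=> mh; rewrite (_ : [set x | r < h x] = h @^-1` `]r, +oo[).
  by rewrite -[X in measurable X]setTI; exact: mh.
by apply/seteqP; split => x; rewrite /= in_itv/= andbT.
Qed.

Section kolmogorov.
Context d (T : measurableType d) (R : realType) (mu : {measure set T -> \bar R}).

(** A discrete layer-cake bound: for [h > r0] the single term with [2^k r0 < h <= 2^(k+1) r0]
    already dominates [h]. *)
Lemma dyadic_upper_bound (h r0 : R) : 0 < r0 ->
  (h%:E <= r0%:E + \sum_(k <oo) (2 ^+ k.+1 * r0 * (2 ^+ k * r0 < h)%R%:R)%R%:E)%E.
Proof.
move=> r00; have tge0 k : (0 <= (2 ^+ k.+1 * r0 * (2 ^+ k * r0 < h)%R%:R)%R%:E)%E.
  by rewrite lee_fin !mulr_ge0// ltW.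
have [hr|hr] := leP h r0; first by rewrite -[leLHS]adde0 leeD ?lee_fin ?nneseries_ge0.
have [k [k1 k2]] : exists k : nat, 2 ^+ k < h / r0 /\ h / r0 <= 2 ^+ k.+1.
  by apply: dyadic_scale; rewrite ltr_pdivlMr ?mul1r.
move: k1 k2; rewrite ltr_pdivlMr// ler_pdivrMr// => k1 k2.
rewrite -[leLHS]add0e; apply: leeD; first by rewrite lee_fin ltW.
rewrite (@nneseriesD1 _ _ k)//= k1 mulr1 -[leLHS]adde0.
by apply: leeD; [rewrite lee_fin|exact: nneseries_ge0].
Qed.

(** The distribution bound is required only inside [E], so that a weak Morrey bound tested on one
    cube containing [E] is enough. [C] is uniform in [E], [h] and [K]. *)
Definition kolmogorov_constant (q C : R) : Prop :=
  forall (E : set T) (h : T -> R) (K : R),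
    measurable E -> (mu E < +oo)%E -> measurable_fun setT h ->
    (forall x, 0 <= h x) -> 0 < K ->
    (forall r, 0 < r ->
      (mu (E `&` [set x | (r < h x)%R]) <= (K * r `^ (- q))%R%:E)%E) ->
    (\int[mu]_(x in E) (h x)%:E <=
       (C * K `^ q^-1 * fine (mu E) `^ (1 - q^-1))%R%:E)%E.

(* Integrating [dyadic_upper_bound] gives [r0 |E| + O(K r0^(1-q))]; the choice
   [r0 = (K / |E|)^(1/q)] balances the two terms. *)
Lemma kolmogorov (q : R) :
  1 < q -> exists2 C : R, 0 < C & kolmogorov_constant q C.
Proof.
move=> q1; pose c : R := 2 `^ (1 - q).
have q0 : 0 < q by lra.
have c0 : 0 < c by rewrite powR_gt0.
have c1 : c < 1 by rewrite /c /powR gt_eqF// expR_lt1 nmulr_rlt0 ?subr_lt0// ln_gt0// ltr1n.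
(* The [1] pays for [r0 |E|]; [2 / (1 - c)] sums the dyadic levels, of ratio [c = 2^(1-q)], the [2]
   being the gap between [2^k] and [2^(k+1)]. *)
exists (1 + 2 / (1 - c)).
  by rewrite addr_gt0// divr_gt0// subr_gt0.
move=> E h K mE Efin mh h0 K0 Hh.
(* Null sets go first, because [r0] has [|E|] in its denominator. *)
have [E0|Epos] := eqVneq (mu E) 0%E.
  rewrite null_set_integral//; last exact/measurable_EFinP/measurable_funTS.
  by rewrite lee_fin !mulr_ge0// ?powR_ge0// addr_ge0// divr_ge0// subr_ge0 ltW.
have finE : mu E \is a fin_num by rewrite ge0_fin_numE.
have muE0 : 0 < fine (mu E).
  by rewrite fine_gt0// lt0e Epos measure_ge0 ltey_eq finE.
set m := fine (mu E) in muE0 *.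
pose r0 := (K / m) `^ q^-1.
have r00 : 0 < r0 by rewrite powR_gt0// divr_gt0.
pose S k := [set x | 2 ^+ k * r0 < h x].
have mS k : measurable (S k) by exact: measurable_superlevel.
pose t k x := (2 ^+ k.+1 * r0 * (2 ^+ k * r0 < h x)%R%:R)%R%:E.
have tE k x : t k x = ((2 ^+ k.+1 * r0)%R%:E * (\1_(S k) x)%:E)%E.
  rewrite /t EFinM indicE; congr (_ * (_%:R)%:E)%E.
  by congr nat_of_bool; apply/idP/idP; rewrite inE.
have mt k : measurable_fun E (t k).
  apply: (@eq_measurable_fun _ _ _ _ _ (fun x => (2 ^+ k.+1 * r0)%R%:E * (\1_(S k) x)%:E)%E).
    by move=> x _; rewrite tE.
  by apply: measurable_funeM; apply/measurable_EFinP/measurable_funTS/measurable_indic.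
have t0 k x : (0 <= t k x)%E by rewrite lee_fin !mulr_ge0// ltW.
have le1 : (\int[mu]_(x in E) (h x)%:E <=
    \int[mu]_(x in E) (r0%:E + \sum_(k <oo) t k x))%E.
  apply: ge0_le_integral => //.
  - by move=> x _; rewrite lee_fin.
  - exact/measurable_EFinP/measurable_funTS.
  - by apply: emeasurable_funD => //; exact: ge0_emeasurable_sum.
  - by move=> x _; exact: dyadic_upper_bound.
apply: (le_trans le1); rewrite ge0_integralD//; last 3 first.
- by move=> x _; rewrite lee_fin ltW.
- by move=> x _; rewrite nneseries_ge0.
- exact: ge0_emeasurable_sum.
rewrite integral_cst// integral_nneseries//.
have lek k : (\int[mu]_(x in E) t k x <= (2 * K * r0 `^ (1 - q) * c ^+ k)%R%:E)%E.
  under eq_integral do rewrite tE.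
  rewrite ge0_integralZl//; last by rewrite lee_fin mulr_ge0// ltW.
    2: exact/measurable_EFinP/measurable_funTS/measurable_indic.
  rewrite integral_indic// setIC.
  have p0 : 0 < 2 ^+ k * r0 by rewrite mulr_gt0// exprn_gt0.
  apply: (@le_trans _ _ ((2 ^+ k.+1 * r0)%R%:E * (K * (2 ^+ k * r0) `^ (- q))%R%:E)%E).
    apply: lee_wpmul2l; last exact: Hh.
    by rewrite lee_fin mulr_ge0// ltW.
  have -> : c ^+ k = (2 ^+ k) `^ (1 - q).
    by rewrite -powR_mulrn ?powR_ge0// powRAC powR_mulrn.
  rewrite -EFinM lee_fin powRM ?exprn_ge0 ?(ltW r00)// !powR1B ?exprn_gt0// exprS.
  rewrite le_eqVlt; apply/orP; left; apply/eqP; ring.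
apply: (@le_trans _ _ (r0%:E * mu E + (2 * K * r0 `^ (1 - q) / (1 - c))%R%:E)%E).
  rewrite leeD2l//.
  apply: (@le_trans _ _ (\sum_(k <oo) (2 * K * r0 `^ (1 - q) * c ^+ k)%R%:E)%E).
    by apply: lee_nneseries => [k _ _|k _]; [apply: integral_ge0|exact: lek].
  apply: lime_le.
    apply: is_cvg_nneseries => k _ _.
    by rewrite lee_fin !mulr_ge0 ?powR_ge0 ?exprn_ge0// ltW.
  apply: nearW => N; rewrite sumEFin lee_fin.
  apply: geometric_le_lim => //; last by rewrite ger0_norm// ltW.
  by rewrite !mulr_ge0 ?powR_ge0// ltW.
rewrite -(fineK finE) -EFinM -EFinD lee_fin -/m.
have r0E : r0 = K `^ q^-1 * m `^ (- q^-1).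
  by rewrite /r0 powRM ?invr_ge0 ?(ltW muE0) ?(ltW K0)// -(powR_inv1 (ltW muE0)) -powRrM mulN1r.
(* The balance of the two terms: [r0^q = K / m], hence [K r0^(1-q) = r0 m]. *)
have -> : 2 * K * r0 `^ (1 - q) = 2 * (r0 * m).
  rewrite powR1B// powRN -powRrM mulVf ?gt_eqF// powRr1 ?divr_ge0// ?ltW//.
  by field; rewrite !gt_eqF.
rewrite r0E powR1B//.
rewrite le_eqVlt; apply/orP; left; apply/eqP; field; rewrite subr_eq0 gt_eqF//.
Qed.
End kolmogorov.

(** * Vitali covering *)

(** Serves both sortings of the cubes, [kappa j] being the class of [j]. Finitely many classes occur
    below [m], so a partial sum of the geometric series suffices, and the bound is free of [m]. *)
Lemma sum_geometric_le (R : realType) (m : nat) (b : pred nat) (w : nat -> R)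
    (kappa : nat -> nat) (B rho : R) :
  0 <= B -> 0 < rho -> rho < 1 ->
  (forall k, \sum_(0 <= j < m | b j && (kappa j == k)) w j <= B * rho ^+ k) ->
  \sum_(0 <= j < m | b j) w j <= B / (1 - rho).
Proof.
move=> B0 rho0 rho1 H.
pose M := \max_(0 <= j < m) kappa j.
have kM j : j \in index_iota 0 m -> (kappa j < M.+1)%N.
  by move=> jm; rewrite ltnS; apply: leq_bigmax_seq.
have -> : \sum_(0 <= j < m | b j) w j =
    \sum_(0 <= k < M.+1) \sum_(0 <= j < m | b j && (kappa j == k)) w j.
  rewrite (exchange_big_dep b) /=; last by move=> k j _ /andP[].
  rewrite big_seq_cond [RHS]big_seq_cond; apply: eq_bigr => j /andP[jm bj].
  under eq_bigl do rewrite bj /=.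
  by rewrite big_mkord (big_pred1 (Ordinal (kM _ jm)))// => i; rewrite eq_sym.
apply: (@le_trans _ _ (series (geometric B rho) M.+1)).
  by apply: ler_sum => k _; exact: H.
by apply: geometric_le_lim => //; rewrite ger0_norm// ltW.
Qed.

Section vitali.
Context d (T : measurableType d) (R : realType) (mu : {measure set T -> \bar R}).

(* The tail of [s] holds the sets of larger [r], so the greedy choice of Vitali
   is a plain induction on [s]. *)
Lemma vitali_selection (I : choiceType) (F G : I -> set T) (r : I -> R) (E : set T)
    (s : seq I) :
  measurable E -> (forall i, measurable (F i)) -> (forall i, F i `<=` G i) ->
  (forall i j, r i <= r j -> F i `&` F j !=set0 -> F i `<=` G j) ->
  sorted (fun i j => r i <= r j) s ->
  exists D : seq I, [/\ {subset D <= s},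
    forall i, i \in s -> exists2 j, j \in D & F i `<=` G j &
    (\sum_(j <- D) mu (E `&` F j) <= mu (E `&` \big[setU/set0]_(j <- D) F j))%E].
Proof.
move=> mE mF FG meetG; elim: s => [_|x s IH xs].
  by exists [::]; split => //; rewrite !big_nil setI0 measure0.
have [D [Ds Dcov Dsum]] := IH (path_sorted xs).
have rx j : j \in s -> r x <= r j.
  have tr : transitive (fun i j => r i <= r j) by move=> ? ? ?; exact: le_trans.
  by move: xs; rewrite /= (path_sortedE tr) => /andP[/allP + _]; apply.
have [[j jD xj]|nmeet] := pselect (exists2 j, j \in D & F x `&` F j !=set0).
  exists D; split => //.
    by move=> i /Ds; rewrite inE => ->; rewrite orbT.
  move=> i; rewrite inE => /orP[/eqP ->|/Dcov//].
  by exists j => //; apply: meetG => //; exact/rx/Ds.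
(* A set meeting no selected one joins the selection, which stays disjoint; the third clause records
   this disjointness in the form needed for measures inside [E]. *)
exists (x :: D); split.
- by move=> i; rewrite !inE => /orP[->//|/Ds ->]; rewrite orbT.
- move=> i; rewrite inE => /orP[/eqP ->|/Dcov[j jD Fij]].
    by exists x; rewrite ?mem_head//; exact: FG.
  by exists j; rewrite // inE jD orbT.
rewrite !big_cons setIUr measureU//.
- by rewrite leeD2l.
- exact: measurableI.
- by apply: measurableI => //; apply: bigsetU_measurable.
apply/seteqP; split => // y [[_ Fxy] [_]]; rewrite -bigcup_seq => -[j /= jD Fjy].
by apply: nmeet; exists j => //; exists y.
Qed.

(** In substance the weak-type bound for the maximal function of [1_E]: the enlargements of the
    selected sets cover the union, each is paid for by its own part of [E], and these parts are
    disjoint. *)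
Lemma vitali_measure_le (I : choiceType) (F G : I -> set T) (r : I -> R)
    (E : set T) (A : R) (s : seq I) :
  measurable E -> (forall i, measurable (F i)) -> (forall i, measurable (G i)) ->
  (forall i, F i `<=` G i) ->
  (forall i j, r i <= r j -> F i `&` F j !=set0 -> F i `<=` G j) ->
  0 <= A -> (forall i, i \in s -> (mu (G i) <= A%:E * mu (E `&` F i))%E) ->
  (mu (\big[setU/set0]_(i <- s) F i) <= A%:E * mu E)%E.
Proof.
move=> mE mF mG FG meetG A0 GE.
pose ord i j := r i <= r j.
have ot : total ord by move=> i j; exact: le_total.
have [D [Ds Dcov Dsum]] :=
  vitali_selection mE mF FG meetG (sort_sorted ot s).
apply: (@le_trans _ _ (mu (\big[setU/set0]_(j <- D) G j))).
  apply: le_measure; rewrite ?inE; [exact: bigsetU_measurable..|].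
  rewrite -!bigcup_seq => x [i /= si Fix].
  have [|j jD Fij] := Dcov i; first by rewrite mem_sort.
  by exists j => //; exact: Fij.
apply: (@le_trans _ _ (\sum_(j <- D) mu (G j))%E).
  elim: D {Ds Dcov Dsum} => [|j D IHD]; first by rewrite !big_nil measure0.
  rewrite !big_cons; 
  apply: (@le_trans _ _ (mu (G j) + mu (\big[setU/set0]_(i <- D) G i))%E).
    by apply: measureU2 => //; exact: bigsetU_measurable.
  by rewrite leeD2l.
apply: (@le_trans _ _ (\sum_(j <- D) A%:E * mu (E `&` F j))%E).
  rewrite big_seq [leRHS]big_seq; apply: lee_sum => j jD; apply: GE.
  by rewrite -(mem_sort ord) Ds.
rewrite -ge0_sume_distrr//; apply: lee_wpmul2l; first by rewrite lee_fin.
apply: (le_trans Dsum); apply: le_measure; rewrite ?inE//.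
by apply: measurableI => //; exact: bigsetU_measurable.
Qed.
End vitali.

(** * Integral estimate for sums of atoms *)

Lemma powR_expR (R : realType) (x a : R) : 0 < x -> x `^ a = expR (a * ln x).
Proof. by move=> x0; rewrite /powR gt_eqF. Qed.

Lemma ler_powR_neg (R : realType) (x y a : R) : 0 < x -> x <= y -> a <= 0 ->
  y `^ a <= x `^ a.
Proof.
move=> x0 xy a0; have y0 : 0 < y by exact: lt_le_trans xy.
by rewrite !powR_expR// ler_expR ler_wnM2l// ler_ln.
Qed.

Lemma powR_lt1 (R : realType) (x a : R) : 1 < x -> a < 0 -> x `^ a < 1.
Proof.
move=> x1 a0; rewrite powR_expR; last exact: lt_trans x1.
by rewrite expR_lt1 nmulr_rlt0// ln_gt0.
Qed.

Lemma measurable_eq_pinfty d (T : measurableType d) (R : realType)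
    (F : T -> \bar R) :
  measurable_fun setT F -> measurable [set x | F x = +oo%E].
Proof.
move=> mF; have -> : [set x | F x = +oo%E] = [set x | (+oo <= F x)%E].
  by apply/seteqP; split => x /=; rewrite leye_eq => /eqP.
by rewrite -[X in measurable X]setTI; apply: emeasurable_fun_c_infty.
Qed.

Section cubes.
Context d (T : measurableType d) (R : realType) (mu : {measure set T -> \bar R}).
Context (n : nat) (X : 'I_n -> T -> R).

(* Only the coordinate functions [X] of the ambient space and the volume of the
   boxes matter for the estimate. *)
Definition cbox (c : 'I_n -> R) (l : R) : set T :=
  [set x | forall i, c i <= X i x <= c i + l].

Definition cube_on (c : 'I_n -> R) (l : R) (Q : set T) : Prop :=
  [/\ 0 < l, measurable Q, Q `<=` cbox c l & mu Q = (l ^+ n)%R%:E].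

Lemma cbox_absorb c l c' l' k L : cbox c l `&` cbox c' l' !=set0 ->
  l' <= k -> l + 2 * k <= L -> cbox c' l' `<=` cbox (fun i => c i - k) L.
Proof.
move=> [x [cx cx']] lk kL y cy i.
move: (cx i) (cx' i) (cy i) => /andP[? ?] /andP[? ?] /andP[? ?].
by apply/andP; split; lra.
Qed.

(* [l_ j] is the side of [Q_ j]; [weakA] and [weakG] are the weak Morrey bounds on
   the atoms and on the majorant, after the reduction to [v = 1]. *)
Section estimate.
Context (box_cube : forall c l, 0 < l -> cube_on c l (cbox c l)).
Context (p q s t Cq Ct N : R).
Context (q1 : 1 < q) (qp : q <= p) (qt : q < t) (ts : t <= s) (N0 : 0 < N).
Context (Cq0 : 0 < Cq) (HCq : kolmogorov_constant mu q Cq).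
Context (Ct0 : 0 < Ct) (HCt : kolmogorov_constant mu t Ct).
Context (c_ : nat -> 'I_n -> R) (l_ : nat -> R) (Q_ : nat -> set T).
Context (Q_cube : forall j, cube_on (c_ j) (l_ j) (Q_ j)).
Context (w : nat -> R) (w0 : forall j, 0 <= w j).
Context (A : nat -> T -> R) (A0 : forall j x, 0 <= A j x).
Context (mA : forall j, measurable_fun setT (A j)).
Context (A_supp : forall j x, A j x != 0 -> Q_ j x).
Context (weakA : forall j c l P r, cube_on c l P -> 0 < r ->
  (mu (P `&` [set x | (r < A j x)%R]) <=
   ((l_ j ^+ n) `^ (t / s) * (l ^+ n) `^ (1 - t / s) * r `^ (- t))%R%:E)%E).
Context (weakG : forall m c l r, 0 < l -> 0 < r ->
  (mu (cbox c l `&` [set x | (r < \sum_(0 <= j < m) w j * \1_(Q_ j) x)%R]) <=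
   (N `^ q * (l ^+ n) `^ (1 - q / p) * r `^ (- q))%R%:E)%E).

Let q0 : 0 < q. Proof. exact: lt_trans q1. Qed.
Let p0 : 0 < p. Proof. exact: lt_le_trans qp. Qed.
Let t0 : 0 < t. Proof. exact: lt_trans qt. Qed.
Let s0 : 0 < s. Proof. exact: lt_le_trans ts. Qed.

Lemma cube_fin c l Q : cube_on c l Q -> (mu Q < +oo)%E.
Proof. by move=> [_ _ _ ->]; rewrite ltry. Qed.

Lemma cube_sub_fin c l Q E : cube_on c l Q -> measurable E -> E `<=` Q ->
  (mu E < +oo)%E.
Proof.
move=> cQ mE EQ; apply: le_lt_trans (cube_fin cQ); apply: le_measure; rewrite ?inE//.
by case: cQ.
Qed.

(** [w j * l_ j ^+ n] is the integral of [w j] times the indicator of [Q_ j] over any [U] containing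
    [Q_ j]. The sum is thus at most the integral of the majorant over [U], to which Kolmogorov's
    inequality applies. *)
Lemma weights_le m (b : pred nat) (U : set T) c l : 0 < l ->
  measurable U -> U `<=` cbox c l -> (forall j, (j < m)%N -> b j -> Q_ j `<=` U) ->
  \sum_(0 <= j < m | b j) w j * l_ j ^+ n <=
  Cq * N * fine (mu U) `^ (1 - q^-1) * (l ^+ n) `^ (q^-1 - p^-1).
Proof.
move=> l0 mU Uc QU.
have V0 : 0 < l ^+ n by rewrite exprn_gt0.
pose h x := \sum_(0 <= j < m) w j * \1_(Q_ j) x.
have mQ j : measurable (Q_ j) by case: (Q_cube j).
have wQ0 j x : 0 <= w j * \1_(Q_ j) x :> R by rewrite mulr_ge0// indicE.
have mwQ D j : measurable_fun D (fun x => (w j * \1_(Q_ j) x)%R : R).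
  apply: measurable_funM => //; exact: measurable_indic.
have mh : measurable_fun setT h by apply: measurable_sum => j; exact: mwQ.
have Ufin : (mu U < +oo)%E := cube_sub_fin (box_cube c l0) mU Uc.
have := HCq mU Ufin mh _ _ (K := N `^ q * (l ^+ n) `^ (1 - q / p)).
move=> /(_ (fun x => sumr_ge0 _ (fun j _ => wQ0 j x))).
move=> /(_ (mulr_gt0 (powR_gt0 _ N0) (powR_gt0 _ V0))) H.
have {}H := H _; rewrite -lee_fin; apply: le_trans (le_trans (H _) _).
- rewrite -sumEFin.
  under eq_integral do rewrite -sumEFin.
  rewrite ge0_integral_sum//; last 2 first.
  + by move=> j; apply/measurable_EFinP.
  + by move=> j x _; rewrite lee_fin.
  rewrite big_mkcond /= big_nat [leRHS]big_nat; apply: lee_sum => j /andP[_ jm].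
  case: ifPn => bj; last by apply: integral_ge0 => x _; rewrite lee_fin.
  under eq_integral do rewrite EFinM.
  rewrite ge0_integralZl_EFin//; last first.
    exact/measurable_EFinP/measurable_indic.
  rewrite integral_indic//; have [_ _ _ QE] := Q_cube j.
  by rewrite setIidl ?QE//; exact: QU.
- move=> r r0; apply: le_trans (weakG m c l0 r0).
  apply: le_measure; rewrite ?inE; last exact: setSI.
  + by apply: measurableI => //; exact: measurable_superlevel.
  + apply: measurableI; last exact: measurable_superlevel.
    by have [] := box_cube c l0.
rewrite lee_fin powRM ?powR_ge0// -!powRrM mulfV ?gt_eqF// powRr1 ?(ltW N0)//.
have -> : (1 - q / p) * q^-1 = q^-1 - p^-1 by field; rewrite !gt_eqF.
by rewrite le_eqVlt; apply/orP; left; apply/eqP; ring.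
Qed.

(** * Integrals of single atoms *)

Let I (E : set T) j : R := fine (\int[mu]_(x in E) (A j x)%:E).

(** Kolmogorov's inequality with exponent [t], fed with the weak Morrey bound of the atom on [P].
    The cube [P] stays free: it will be [Q_ j] itself for the small cubes and the ambient cube for
    the large ones. *)
Lemma local_le E c l P j : cube_on c l P -> measurable E -> E `<=` P ->
  (\int[mu]_(x in E) (A j x)%:E <=
   (Ct * (l_ j ^+ n) `^ s^-1 * (l ^+ n) `^ (t^-1 - s^-1) *
    fine (mu E) `^ (1 - t^-1))%R%:E)%E.
Proof.
move=> cP mE EP; have [l0 mP _ _] := cP; have [lj0 _ _ _] := Q_cube j.
have V0 : 0 < l ^+ n by rewrite exprn_gt0.
have Vj0 : 0 < l_ j ^+ n by rewrite exprn_gt0.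
apply: le_trans (HCt mE (cube_sub_fin cP mE EP) (mA j) (A0 j)
  (mulr_gt0 (powR_gt0 (t / s) Vj0) (powR_gt0 (1 - t / s) V0)) _) _.
  move=> r r0; apply: le_trans (weakA j cP r0); apply: le_measure; rewrite ?inE.
  + by apply: measurableI => //; exact: measurable_superlevel.
  + by apply: measurableI => //; exact: measurable_superlevel.
  + exact: setSI.
rewrite lee_fin powRM ?powR_ge0// -!powRrM.
have -> : t / s * t^-1 = s^-1 by field; rewrite !gt_eqF.
have -> : (1 - t / s) * t^-1 = t^-1 - s^-1 by field; rewrite !gt_eqF.
by rewrite !mulrA.
Qed.

Lemma I_EFin E c l P j : cube_on c l P -> measurable E -> E `<=` P ->
  (\int[mu]_(x in E) (A j x)%:E = (I E j)%:E)%E.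
Proof.
move=> cP mE EP; rewrite fineK// ge0_fin_numE.
  exact: le_lt_trans (local_le j cP mE EP) (ltry _).
by apply: integral_ge0 => x _; rewrite lee_fin.
Qed.

Lemma I_global E c l P j : cube_on c l P -> measurable E -> E `<=` P ->
  I E j <= Ct * (l_ j ^+ n) `^ s^-1 * (l ^+ n) `^ (t^-1 - s^-1) *
    fine (mu E) `^ (1 - t^-1).
Proof.
by move=> cP mE EP; rewrite -lee_fin -(I_EFin j cP mE EP); exact: (local_le j cP mE EP).
Qed.

(** [A j] vanishes off [Q_ j], so [E] may be cut down to its part in [Q_ j] and the test cube taken
    to be [Q_ j]; the two powers of its volume then merge into the exponent [1/t]. *)
Lemma I_local E c l P j : cube_on c l P -> measurable E -> E `<=` P ->
  I E j <= Ct * (l_ j ^+ n) `^ t^-1 * fine (mu (E `&` Q_ j)) `^ (1 - t^-1).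
Proof.
move=> cP mE EP; have cj := Q_cube j; have [lj0 mQ _ _] := cj.
have Vj0 : 0 < l_ j ^+ n by rewrite exprn_gt0.
have -> : I E j = I (E `&` Q_ j) j.
  rewrite /I integral_mkcondr; congr fine.
  apply: eq_integral => x _; rewrite patchE.
  have [Qx|Qx] := pselect (Q_ j x); first by rewrite mem_set.
  rewrite memNset//; congr EFin; apply/eqP/negPn/negP => /A_supp; exact: Qx.
have := I_global j cj (measurableI _ _ mE mQ) (@subIsetr _ _ _).
rewrite -(mulrA Ct) -powRD; last by apply/implyP => _; rewrite gt_eqF.
by rewrite addrC subrK.
Qed.

(* By Vitali, the cubes in which [E] has density at least [2^-k] have a union of
   measure at most [3^n 2^k |E|]. *)
Lemma weights_density_le E c l Q m (b : pred nat) (k : nat) :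
  cube_on c l Q -> measurable E -> E `<=` Q ->
  (forall j, b j -> [/\ l_ j <= l, Q_ j `&` Q !=set0 &
     l_ j ^+ n <= 2 ^+ k * fine (mu (E `&` Q_ j))]) ->
  \sum_(0 <= j < m | b j) w j * l_ j ^+ n <=
  Cq * N * (3 ^+ n * 2 ^+ k * fine (mu E)) `^ (1 - q^-1) *
    (3 ^+ n * l ^+ n) `^ (q^-1 - p^-1).
Proof.
move=> cQ mE EQ bP; have [l0 mQ Qc _] := cQ.
have mQ_ j : measurable (Q_ j) by have [] := Q_cube j.
have l_gt0 j : 0 < l_ j by have [] := Q_cube j.
have l3 j : 0 < 3 * l_ j by rewrite mulr_gt0.
pose U := \big[setU/set0]_(j <- [seq j <- index_iota 0 m | b j]) Q_ j.
have mU : measurable U by exact: bigsetU_measurable.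
have UE : (mu U <= (3 ^+ n * 2 ^+ k)%R%:E * mu E)%E.
  apply: (@vitali_measure_le _ _ _ _ _ _
    (fun j => cbox (fun i => c_ j i - l_ j) (3 * l_ j)) l_) => //.
  - by move=> j; have [] := box_cube (fun i => c_ j i - l_ j) (l3 j).
  - move=> j x Qx; have [_ _ /(_ _ Qx) cx _] := Q_cube j.
    by apply: (cbox_absorb (l := l_ j) (l' := l_ j) (c' := c_ j) (c := c_ j) _ (lexx _) _ cx);
      [exists x|lra].
  - move=> i j lij [y [Qiy Qjy]] x Qx.
    have [_ _ Qci _] := Q_cube i; have [_ _ Qcj _] := Q_cube j.
    apply: (cbox_absorb (l := l_ j) (c := c_ j) (c' := c_ i) _ lij _ (Qci _ Qx)); last lra.
    by exists y; split; [exact: Qcj|exact: Qci].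
  - move=> j; rewrite mem_filter => /andP[bj _].
    have [_ _ _ ->] := box_cube (fun i => c_ j i - l_ j) (l3 j).
    have [_ _ lj] := bP j bj; have fE := cube_sub_fin cQ (measurableI _ _ mE (mQ_ j)) (subIset (or_introl EQ)).
    rewrite -[mu (E `&` _)]fineK ?ge0_fin_numE// -EFinM lee_fin exprMn -mulrA.
    by rewrite ler_wpM2l.
(* Cubes meeting [Q] and not larger than it stay within the triple of [Q], which is the box in which
   the majorant is tested. *)
have UC : U `<=` cbox (fun i => c i - l) (3 * l).
  rewrite /U -bigcup_seq => x [j /=]; rewrite mem_filter => /andP[bj _] Qjx.
  have [lj [y [Qjy Qy]] _] := bP j bj; have [_ _ Qcj _] := Q_cube j.
  apply: (cbox_absorb (l := l) (c := c) (c' := c_ j) _ lj _ (Qcj _ Qjx)); last lra.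
  by exists y; split; [exact: Qc|exact: Qcj].
apply: le_trans (weights_le (m := m) (b := b) (mulr_gt0 (ltr0Sn _ 2) l0) mU UC _) _.
  move=> j jm bj; rewrite /U -bigcup_seq => x Qx; exists j => //=.
  by rewrite mem_filter bj mem_index_iota.
rewrite exprMn ler_wpM2r ?powR_ge0// ler_wpM2l ?mulr_ge0 ?(ltW Cq0) ?(ltW N0)//.
have fE : mu E \is a fin_num by rewrite ge0_fin_numE//; exact: cube_sub_fin cQ mE EQ.
rewrite ge0_ler_powR ?nnegrE ?fine_ge0 ?mulr_ge0 ?fine_ge0//.
  by rewrite subr_ge0 invf_le1// ltW.
rewrite -lee_fin fineK; first by rewrite EFinM fineK.
rewrite ge0_fin_numE//; apply: le_lt_trans UE _.
by rewrite -(fineK fE) -EFinM ltry.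
Qed.

(** [2^(1-1/t)] is the dyadic rounding of the density. The power of [3^n] collects [1 - 1/q] from
    Vitali's enlargement and [1/q - 1/p] from the tripling of [Q]. The denominator sums the
    geometric series. *)
Definition small_cst : R :=
  Ct * 2 `^ (1 - t^-1) * Cq * (3 ^+ n) `^ (1 - p^-1) / (1 - 2 `^ (t^-1 - q^-1)).

Lemma small_cst_gt0 : 0 < small_cst.
Proof.
rewrite divr_gt0 ?mulr_gt0 ?powR_gt0 ?exprn_gt0// subr_gt0.
by rewrite powR_lt1 ?ltr1n// subr_lt0 ltf_pV2.
Qed.

(* Grouping the cubes by the density [|E n Q_j| / |Q_j| ~ 2^-k] leaves a geometric
   sum of ratio [2^(1/t - 1/q)]. *)
Lemma small_part E c l Q m (b : pred nat) :
  cube_on c l Q -> measurable E -> E `<=` Q ->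
  (forall j, b j -> [/\ l_ j <= l, Q_ j `&` Q !=set0 &
     0 < fine (mu (E `&` Q_ j))]) ->
  \sum_(0 <= j < m | b j) w j * I E j <=
  small_cst * N * fine (mu E) `^ (1 - q^-1) * (l ^+ n) `^ (q^-1 - p^-1).
Proof.
move=> cQ mE EQ bP; have [l0 mQ Qc _] := cQ.
have mQ_ j : measurable (Q_ j) by have [] := Q_cube j.
have V0 j : 0 < l_ j ^+ n by have [? _ _ _] := Q_cube j; rewrite exprn_gt0.
pose e j := fine (mu (E `&` Q_ j)).
have eV j : e j <= l_ j ^+ n.
  rewrite /e; have [_ _ _ QE] := Q_cube j; rewrite -lee_fin -QE fineK.
    by apply: le_measure; rewrite ?inE//; exact: measurableI.
  rewrite ge0_fin_numE//.
  exact: cube_sub_fin cQ (measurableI _ _ mE (mQ_ j)) (subIset (or_introl EQ)).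
have /choice[kappa kP] : forall j, exists k, b j ->
    2 ^+ k * e j <= 2 * l_ j ^+ n /\ l_ j ^+ n <= 2 ^+ k * e j.
  move=> j; have [bj|] := boolP (b j); last by exists 0%N.
  have [_ _ ej] := bP j bj.
  (* The ratio is doubled because [dyadic_scale] needs a number above [1], while [|Q_j| / e j]
     equals [1] when [E] fills [Q_ j] up to a null set. *)
  have [k []] : exists k : nat, 2 ^+ k < 2 * l_ j ^+ n / e j /\
      2 * l_ j ^+ n / e j <= 2 ^+ k.+1.
    apply: dyadic_scale; rewrite ltr_pdivlMr// mul1r.
    by have := eV j; have := V0 j; lra.
  rewrite ltr_pdivlMr// ler_pdivrMr// exprS -mulrA ler_pM2l// => k1 k2.
  by exists k; split => //; exact: ltW.
set rho := 2 `^ (t^-1 - q^-1).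
have rho0 : 0 < rho by rewrite powR_gt0.
have tq : t^-1 < q^-1 by rewrite ltf_pV2.
have rho1 : rho < 1.
  by rewrite powR_lt1 ?subr_lt0// ltr1n.
have t1 : 0 <= 1 - t^-1 by rewrite subr_ge0 invf_le1// ltW// (lt_trans q1).
apply: le_trans (@sum_geometric_le _ m b _ kappa (Ct * 2 `^ (1 - t^-1) * Cq *
  (3 ^+ n) `^ (1 - p^-1) * N * fine (mu E) `^ (1 - q^-1) *
  (l ^+ n) `^ (q^-1 - p^-1)) rho _ rho0 rho1 _) _; last first.
- by rewrite /small_cst -/rho le_eqVlt; apply/orP; left; apply/eqP; field; rewrite subr_eq0 gt_eqF.
- move=> k.
  apply: (@le_trans _ _ (Ct * (2 / 2 ^+ k) `^ (1 - t^-1) *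
      \sum_(0 <= j < m | b j && (kappa j == k)) w j * l_ j ^+ n)).
    rewrite mulr_sumr; apply: ler_sum => j /andP[bj /eqP kj].
    rewrite mulrCA ler_wpM2l//; apply: le_trans (I_local j cQ mE EQ) _.
    rewrite -!mulrA ler_wpM2l ?(ltW Ct0)//.
    have [+ _] := kP j bj; rewrite kj => ke.
    apply: (@le_trans _ _ ((l_ j ^+ n) `^ t^-1 * (2 / 2 ^+ k * l_ j ^+ n) `^ (1 - t^-1))).
      rewrite ler_wpM2l ?powR_ge0// ge0_ler_powR ?nnegrE ?fine_ge0//.
        by rewrite !mulr_ge0 ?(ltW (V0 j)) ?invr_ge0 ?exprn_ge0.
      by rewrite mulrAC ler_pdivlMr ?exprn_gt0// mulrC.
    rewrite powRM ?(ltW (V0 j)) ?divr_ge0 ?exprn_ge0// mulrCA -powRD; last first.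
      by apply/implyP => _; rewrite gt_eqF.
    by rewrite (addrC t^-1) subrK powRr1// ltW.
  have wd : \sum_(0 <= j < m | b j && (kappa j == k)) w j * l_ j ^+ n <=
      Cq * N * (3 ^+ n * 2 ^+ k * fine (mu E)) `^ (1 - q^-1) *
      (3 ^+ n * l ^+ n) `^ (q^-1 - p^-1).
    apply: weights_density_le cQ mE EQ _ => j /andP[bj /eqP kj].
    by have [? ? ?] := bP j bj; have [_] := kP j bj; rewrite kj.
  apply: (le_trans (ler_wpM2l _ wd)); first by rewrite mulr_ge0 ?powR_ge0// ltW.
  have n0 : 0 <= l ^+ n by rewrite exprn_ge0// ltW.
  rewrite !powRM ?mulr_ge0 ?n0 ?exprn_ge0 ?fine_ge0 ?invr_ge0 ?exprn_ge0//.
  (* Exponents of [2^k]: [-(1 - 1/t)] from the atoms and [1 - 1/q] from the covering, in total the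
     exponent [1/t - 1/q] of [rho]. *)
  have -> : rho ^+ k = (2 ^+ k) `^ (t^-1 - q^-1).
    by rewrite -powR_mulrn ?powR_ge0// powRAC powR_mulrn.
  rewrite -[((2 ^+ k)^-1)]powR_inv1 ?exprn_ge0// -powRrM.
  have -> : (3 ^+ n) `^ (1 - p^-1) = (3 ^+ n) `^ (1 - q^-1) * (3 ^+ n) `^ (q^-1 - p^-1) :> R.
    rewrite -powRD; first by congr (_ `^ _); ring.
    by apply/implyP => _; rewrite gt_eqF// exprn_gt0.
  have -> : (2 ^+ k) `^ (t^-1 - q^-1) = (2 ^+ k) `^ (-1 * (1 - t^-1)) * (2 ^+ k) `^ (1 - q^-1) :> R.
    rewrite -powRD; first by congr (_ `^ _); ring.
    by apply/implyP => _; rewrite gt_eqF// exprn_gt0.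
  by rewrite le_eqVlt; apply/orP; left; apply/eqP; ring.
- by rewrite !mulr_ge0 ?powR_ge0// ltW.
Qed.

(** The [5] comes from [l + 2 * 2^(k+1) l <= 5 * 2^k l]. No covering argument is called for: [U] is
    the whole dilated box, so the exponents [1 - 1/q] and [1/q - 1/p] add up to [1 - 1/p]. *)
Lemma weights_dilate_le c l Q m (b : pred nat) (k : nat) :
  cube_on c l Q ->
  (forall j, b j -> l_ j <= 2 ^+ k.+1 * l /\ Q_ j `&` Q !=set0) ->
  \sum_(0 <= j < m | b j) w j * l_ j ^+ n <=
  Cq * N * ((5 * (2 ^+ k * l)) ^+ n) `^ (1 - p^-1).
Proof.
move=> [l0 mQ Qc _] bP; pose L := 5 * (2 ^+ k * l).
have k1 : 1 <= 2 ^+ k :> R by rewrite exprn_ege1// ler1n.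
have lk : l <= 2 ^+ k * l by rewrite ler_peMl// ltW.
have L0 : 0 < L by rewrite mulr_gt0// mulr_gt0// exprn_gt0.
have [_ mU _ UE] := box_cube (fun i => c i - 2 ^+ k.+1 * l) L0.
apply: le_trans (weights_le (m := m) (b := b) L0 mU (@subset_refl _ _) _) _.
  move=> j _ /bP[lj [y [Qjy Qy]]] x Qjx; have [_ _ Qcj _] := Q_cube j.
  apply: (cbox_absorb (l := l) (c := c) (c' := c_ j) _ lj _ (Qcj _ Qjx)).
    by exists y; split; [exact: Qc|exact: Qcj].
  by rewrite /L exprS; lra.
rewrite UE /= -/L -(mulrA (Cq * N)) -powRD.
  by rewrite addrA subrK.
by apply/implyP => _; rewrite gt_eqF// exprn_gt0.
Qed.

(** The ratio in the denominator is below [1] because [p < s] and [0 < n]; in dimension [0] it would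
    be [1]. *)
Definition large_cst : R :=
  Ct * Cq * (5 ^+ n) `^ (1 - p^-1) / (1 - (2 ^+ n) `^ (s^-1 - p^-1)).

Lemma large_cst_gt0 : (0 < n)%N -> p < s -> 0 < large_cst.
Proof.
move=> n0 ps; rewrite divr_gt0 ?mulr_gt0 ?powR_gt0 ?exprn_gt0// subr_gt0.
by rewrite powR_lt1 ?subr_lt0 ?ltf_pV2// exprn_egt1 ?ltr1n// -lt0n.
Qed.

(* Grouping the cubes by the side [l_j ~ 2^k l] leaves a geometric sum of ratio
   [2^(n (1/s - 1/p))]. *)
Lemma large_part E c l Q m (b : pred nat) : (0 < n)%N -> p < s ->
  cube_on c l Q -> measurable E -> E `<=` Q ->
  (forall j, b j -> l < l_ j /\ Q_ j `&` Q !=set0) ->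
  \sum_(0 <= j < m | b j) w j * I E j <=
  large_cst * N * fine (mu E) `^ (1 - q^-1) * (l ^+ n) `^ (q^-1 - p^-1).
Proof.
move=> n0 ps cQ mE EQ bP; have [l0 mQ Qc QE] := cQ.
have V0 j : 0 < l_ j ^+ n by have [? _ _ _] := Q_cube j; rewrite exprn_gt0.
have /choice[kappa kP] : forall j, exists k, b j ->
    2 ^+ k * l < l_ j /\ l_ j <= 2 ^+ k.+1 * l.
  move=> j; have [bj|] := boolP (b j); last by exists 0%N.
  have [lj _] := bP j bj.
  have [k []] : exists k : nat, 2 ^+ k < l_ j / l /\ l_ j / l <= 2 ^+ k.+1.
    by apply: dyadic_scale; rewrite ltr_pdivlMr// mul1r.
  by rewrite ltr_pdivlMr// ler_pdivrMr// => k1 k2; exists k.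
set rho := (2 ^+ n) `^ (s^-1 - p^-1).
have rho0 : 0 < rho by rewrite powR_gt0// exprn_gt0.
have sp : s^-1 < p^-1 by rewrite ltf_pV2.
have n1 : 1 < 2 ^+ n :> R by rewrite exprn_egt1 ?ltr1n// -lt0n.
have rho1 : rho < 1.
  by rewrite powR_lt1 ?subr_lt0.
have tq : t^-1 < q^-1 by rewrite ltf_pV2.
set e := fine (mu E).
have e0 : 0 <= e by exact: fine_ge0.
have eV : e <= l ^+ n.
  rewrite -lee_fin -QE fineK; first by apply: le_measure; rewrite ?inE.
  by rewrite ge0_fin_numE//; exact: cube_sub_fin cQ mE EQ.
have Vl : 0 < l ^+ n by rewrite exprn_gt0.
apply: le_trans (@sum_geometric_le _ m b _ kappa (Ct * Cq *
  (5 ^+ n) `^ (1 - p^-1) * N * e `^ (1 - q^-1) *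
  (l ^+ n) `^ (q^-1 - p^-1)) rho _ rho0 rho1 _) _; last first.
- rewrite /large_cst -/rho le_eqVlt; apply/orP; left; apply/eqP; field.
  by rewrite subr_eq0 gt_eqF.
- move=> k; set a : R := (2 ^+ k) ^+ n.
  have a0 : 0 < a by rewrite !exprn_gt0.
  apply: (@le_trans _ _ (Ct * (a * l ^+ n) `^ (s^-1 - 1) *
      (l ^+ n) `^ (t^-1 - s^-1) * e `^ (1 - t^-1) *
      \sum_(0 <= j < m | b j && (kappa j == k)) w j * l_ j ^+ n)).
    rewrite mulr_sumr; apply: ler_sum => j /andP[bj /eqP kj].
    rewrite mulrCA ler_wpM2l//; apply: le_trans (I_global j cQ mE EQ) _.
    (* A full factor [l_ j ^+ n] is split off to rebuild the weighted sum. The remaining exponent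
       [1/s - 1] is not positive, so the lower bound [2^k l < l_ j] is the one that helps. *)
    have Hj : (l_ j ^+ n) `^ s^-1 <= (a * l ^+ n) `^ (s^-1 - 1) * l_ j ^+ n.
      have -> : (l_ j ^+ n) `^ s^-1 = (l_ j ^+ n) `^ (s^-1 - 1) * l_ j ^+ n.
        rewrite -[X in _ = _ * X]powRr1 ?(ltW (V0 j))// -powRD ?subrK//.
        by apply/implyP => _; rewrite gt_eqF.
      rewrite ler_wpM2r ?(ltW (V0 j))// ler_powR_neg ?mulr_gt0//.
        have [lj _] := kP j bj; rewrite /a -exprMn -kj ler_pXn2r ?nnegrE ?ltW//.
          by rewrite mulr_gt0// exprn_gt0.
        by have [] := Q_cube j.
      by rewrite subr_le0 invf_le1// ltW// (lt_le_trans _ ts)// (lt_trans q1).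
    apply: (@le_trans _ _ (Ct * ((a * l ^+ n) `^ (s^-1 - 1) * l_ j ^+ n) *
        (l ^+ n) `^ (t^-1 - s^-1) * e `^ (1 - t^-1))).
      by rewrite !ler_wpM2r ?powR_ge0// ler_wpM2l// ltW.
    by rewrite le_eqVlt; apply/orP; left; apply/eqP; ring.
  have wd : \sum_(0 <= j < m | b j && (kappa j == k)) w j * l_ j ^+ n <=
      Cq * N * ((5 * (2 ^+ k * l)) ^+ n) `^ (1 - p^-1).
    apply: weights_dilate_le cQ _ => j /andP[bj /eqP kj].
    by have [? ?] := bP j bj; have [_] := kP j bj; rewrite kj.
  apply: (le_trans (ler_wpM2l _ wd)); first by rewrite !mulr_ge0 ?powR_ge0// ltW.
  have -> : rho ^+ k = a `^ (s^-1 - p^-1).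
    by rewrite -powR_mulrn ?powR_ge0// powRAC powR_mulrn ?exprn_ge0// exprAC.
  (* The exponent [1 - 1/t] is traded for the desired [1 - 1/q], at the cost of a power of [|Q|],
     since [e <= |Q|] and [1/t < 1/q]. *)
  have et : e `^ (1 - t^-1) <= e `^ (1 - q^-1) * (l ^+ n) `^ (q^-1 - t^-1).
    rewrite (_ : 1 - t^-1 = (1 - q^-1) + (q^-1 - t^-1)); last by ring.
    have q_lt1 : q^-1 < 1 by rewrite invf_lt1.
    rewrite powRD; last by apply/implyP => /eqP; lra.
    rewrite ler_wpM2l ?powR_ge0// ge0_ler_powR ?nnegrE// ?subr_ge0 ltW//.
  apply: (@le_trans _ _ (Ct * (a * l ^+ n) `^ (s^-1 - 1) *
      (l ^+ n) `^ (t^-1 - s^-1) * (e `^ (1 - q^-1) * (l ^+ n) `^ (q^-1 - t^-1)) *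
      (Cq * N * ((5 * (2 ^+ k * l)) ^+ n) `^ (1 - p^-1)))).
    rewrite ler_wpM2r// ?mulr_ge0 ?powR_ge0 ?(ltW Cq0) ?(ltW N0)//.
    by rewrite ler_wpM2l// !mulr_ge0 ?powR_ge0 ?(ltW Ct0).
  rewrite exprMn [in X in X `^ (1 - p^-1)]exprMn -/a.
  rewrite !powRM ?mulr_ge0 ?(ltW a0) ?(ltW Vl) ?exprn_ge0//.
  have -> : (l ^+ n) `^ (q^-1 - p^-1) = (l ^+ n) `^ (s^-1 - 1) *
      (l ^+ n) `^ (t^-1 - s^-1) * (l ^+ n) `^ (q^-1 - t^-1) * (l ^+ n) `^ (1 - p^-1).
    rewrite !(powR_expR _ Vl) -!expRD; congr expR; ring.
  have -> : a `^ (s^-1 - p^-1) = a `^ (s^-1 - 1) * a `^ (1 - p^-1).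
    rewrite !(powR_expR _ a0) -!expRD; congr expR; ring.
  by rewrite le_eqVlt; apply/orP; left; apply/eqP; ring.
- by rewrite !mulr_ge0 ?powR_ge0// ltW.
Qed.


(** * The full series of atoms *)

Let H (x : T) : \bar R := (\sum_(j <oo) (w j * A j x)%R%:E)%E.

Let wA_ge0 j x : (0 <= (w j * A j x)%R%:E)%E.
Proof. by rewrite lee_fin mulr_ge0. Qed.

Let mwA D j : measurable_fun D (fun x => (w j * A j x)%R%:E).
Proof. by apply/measurable_EFinP/measurable_funTS/measurable_funM. Qed.

Lemma integral_series_le E c l Q : (0 < n)%N -> p < s ->
  cube_on c l Q -> measurable E -> E `<=` Q ->
  (\int[mu]_(x in E) H x <= ((small_cst + large_cst) * N *
     fine (mu E) `^ (1 - q^-1) * (l ^+ n) `^ (q^-1 - p^-1))%R%:E)%E.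
Proof.
move=> n0 ps cQ mE EQ; rewrite integral_nneseries//.
apply: lime_le; first by apply: is_cvg_nneseries => j _ _; exact: integral_ge0.
apply: nearW => m.
have IE j : (\int[mu]_(x in E) (w j * A j x)%R%:E = (w j * I E j)%R%:E)%E.
  under eq_integral do rewrite EFinM.
  rewrite ge0_integralZl_EFin//.
  - by rewrite (I_EFin j cQ mE EQ).
  - by move=> x _; rewrite lee_fin.
  - exact/measurable_EFinP/measurable_funTS.
under eq_bigr do rewrite IE.
rewrite sumEFin lee_fin.
(* Indices with [|E n Q_j| = 0] contribute nothing by [I_local]. For the others the density is
   positive and [Q_ j] meets [Q], as both sortings demand. *)
pose pos j := 0 < fine (mu (E `&` Q_ j)).
pose small j := (l_ j <= l) && pos j; pose large j := (l < l_ j) && pos j.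
have meet j : pos j -> Q_ j `&` Q !=set0.
  rewrite /pos => ej; apply/set0P/negP => /eqP QQ; move: ej.
  suff -> : E `&` Q_ j = set0 by rewrite measure0 ltxx.
  by apply/seteqP; split => // x [/EQ Qx Qjx]; rewrite -QQ.
apply: (@le_trans _ _ (\sum_(0 <= j < m | small j) w j * I E j +
                       \sum_(0 <= j < m | large j) w j * I E j)).
  rewrite [X in _ <= X + _]big_mkcond [X in _ <= _ + X]big_mkcond -big_split /=; apply: ler_sum => j _.
  rewrite /small /large; have [pj|pj] := boolP (pos j).
    by case: ltP => _ /=; rewrite ?addr0 ?add0r.
  rewrite !andbF addr0 mulr_ge0_le0//; apply: le_trans (I_local j cQ mE EQ) _.
  have -> : fine (mu (E `&` Q_ j)) = 0.
    by apply/eqP; rewrite eq_le fine_ge0// andbT leNgt.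
  by rewrite powR0 ?mulr0// subr_eq0 gt_eqF// invf_lt1// (lt_trans q1).
rewrite !mulrDl lerD//.
  apply: small_part cQ mE EQ _ => j /andP[lj pj]; split => //; exact: meet.
by apply: large_part n0 ps cQ mE EQ _ => j /andP[lj pj]; split => //; exact: meet.
Qed.

Lemma measurable_H D : measurable_fun D H.
Proof. by apply: ge0_emeasurable_sum. Qed.

(** Chebyshev's inequality on [E] itself gives [r |E| <= K |E|^(1-1/q)], where [|E|] is finite
    because [E] lies in a cube; dividing by [|E|^(1-1/q)] yields the weak bound. *)
Lemma superlevel_series_le c l Q r : (0 < n)%N -> p < s -> cube_on c l Q -> 0 < r ->
  r * fine (mu (Q `&` [set x | (r%:E < H x)%E])) `^ q^-1 <=
  (small_cst + large_cst) * N * (l ^+ n) `^ (q^-1 - p^-1).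
Proof.
move=> n0 ps cQ r0; have [l0 mQ _ _] := cQ.
set E := Q `&` _.
have mE : measurable E.
  by apply: emeasurable_fun_o_infty => //; exact: measurable_H.
have EQ : E `<=` Q by move=> x [].
have EH : (r%:E * mu E <= \int[mu]_(x in E) H x)%E.
  rewrite -integral_cst//; apply: ge0_le_integral => //.
  - by move=> x _; rewrite lee_fin ltW.
  - exact: measurable_H.
  - by move=> x [_ /ltW].
have := le_trans EH (integral_series_le n0 ps cQ mE EQ).
have fE : mu E \is a fin_num by rewrite ge0_fin_numE//; exact: cube_sub_fin cQ mE EQ.
rewrite -(fineK fE) -EFinM lee_fin/=; set e := fine (mu E).
have K0 : 0 <= (small_cst + large_cst) * N * (l ^+ n) `^ (q^-1 - p^-1).
  rewrite !mulr_ge0 ?powR_ge0 ?(ltW N0)//.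
  by rewrite addr_ge0 ?(ltW small_cst_gt0) ?(ltW (large_cst_gt0 n0 ps)).
have : 0 <= e by exact: fine_ge0.
rewrite le_eqVlt => /orP[/eqP <- _|e0].
  by rewrite powR0 ?mulr0// invr_eq0 gt_eqF.
have eE : e = e `^ (1 - q^-1) * e `^ q^-1.
  rewrite -powRD ?subrK ?powRr1 ?(ltW e0)//.
  by apply/implyP => _; rewrite gt_eqF.
have -> : r * e = e `^ (1 - q^-1) * (r * e `^ q^-1) by rewrite mulrCA -eE.
by rewrite mulrAC [leRHS]mulrC ler_pM2l// powR_gt0.
Qed.

Lemma ae_series_fin c l Q : (0 < n)%N -> p < s -> cube_on c l Q ->
  mu (Q `&` [set x | H x = +oo%E]) = 0%E.
Proof.
move=> n0 ps cQ; have [l0 mQ _ _] := cQ.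
have mE r : measurable (Q `&` [set x | (r%:E < H x)%E]).
  by apply: emeasurable_fun_o_infty => //; exact: measurable_H.
set S := Q `&` _.
have mS : measurable S.
  by apply: measurableI => //; apply: measurable_eq_pinfty; exact: measurable_H.
have fS : mu S \is a fin_num.
  by rewrite ge0_fin_numE//; apply: cube_sub_fin cQ mS _ => x [].
rewrite -(fineK fS); congr EFin; apply/eqP; rewrite eq_le fine_ge0// andbT leNgt.
apply/negP => S0; have Sq : 0 < fine (mu S) `^ q^-1 by rewrite powR_gt0.
pose K := (small_cst + large_cst) * N * (l ^+ n) `^ (q^-1 - p^-1).
(* The infinite set lies in every superlevel set; this level makes the left side equal to [|K| + 1],
   which exceeds the bound [K]. *)
pose r := (`|K| + 1) / fine (mu S) `^ q^-1.
have r0 : 0 < r by rewrite divr_gt0// ltr_wpDl.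
have : r * fine (mu S) `^ q^-1 <= K.
  apply: le_trans (superlevel_series_le n0 ps cQ r0).
  rewrite ler_pM2l// ge0_ler_powR ?nnegrE ?fine_ge0// ?invr_ge0 ?(ltW q0)//.
  rewrite fine_le//.
    by rewrite ge0_fin_numE//; apply: cube_sub_fin cQ (mE r) _ => x [].
  by apply: le_measure; rewrite ?inE// => x [Qx /= Hx]; split => //=; rewrite Hx ltry.
rewrite /r mulfVK ?gt_eqF//; apply/negP; rewrite -ltNge.
by rewrite (le_lt_trans (ler_norm K))// ltrDl.
Qed.

End estimate.
End cubes.

(** * Lebesgue measure of cubes *)

Section lebesgue_boxes.
Context (R : realType).

Lemma measurable_box n (B : 'I_n -> set (measurableTypeR R)) :
  (forall i, measurable (B i)) ->
  measurable [set x : n.-tuple (measurableTypeR R) | forall i, B i (tnth x i)].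
Proof.
move=> mB; rewrite (_ : [set x | _] = \bigcap_(i in [set: 'I_n])
    ((fun x : n.-tuple (measurableTypeR R) => tnth x i) @^-1` B i)).
  apply: fin_bigcap_measurable => //= i _.
  by rewrite -[X in measurable X]setTI; exact: (measurable_tnth i).
by apply/seteqP; split => x /= H i; [move=> _|]; exact: H.
Qed.

(** Induction along the recursive construction: pulling a box back through [consT] splits off its
    head side as a product. In dimension [0] the box is the whole one-point space, of mass the empty
    product. *)
Lemma borel_lebesgue_box n (B : 'I_n -> set (measurableTypeR R)) :
  (forall i, measurable (B i)) ->
  borel_lebesgue R n [set x | forall i, B i (tnth x i)] =
  (\prod_(i < n) (@lebesgue_measure R) (B i))%E.
Proof.
elim: n B => [|n IH] B mB.
  rewrite big_ord0 /= diracE (_ : [set x | _] = setT) ?in_setT//.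
  by apply/seteqP; split => // x _ [].
rewrite big_ord_recl -IH// /= /borel_lebesgue_step /pushforward.
have -> : @consT R n @^-1` [set x | forall i, B i (tnth x i)] =
    B ord0 `*` [set y | forall i, B (lift ord0 i) (tnth y i)].
  apply/seteqP; split => [[x y]|[x y]] /=.
    move=> H; split; first by have := H ord0; rewrite tnth0.
    by move=> i; have := H (lift ord0 i); rewrite tnthS.
  move=> [Bx By] i; case: (unliftP ord0 i) => [j ->|->].
    by rewrite tnthS; exact: By.
  by rewrite tnth0.
rewrite product_measure1E//.
exact: (@measurable_box n (fun i => B (lift ord0 i)) (fun i => mB _)).
Qed.

Lemma leb_borel n (Q : set (n.-tuple (measurableTypeR R))) :
  measurable Q -> measurable (Q : set (Rn R n)) /\ leb R n Q = borel_lebesgue R n Q.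
Proof.
move=> mQ; split.
  by apply: (@sub_caratheodory _ _ R (borel_lebesgue R n)); exact: sub_gen_smallest.
exact: measurable_mu_extE.
Qed.

(** The choice of faces is forgotten here: it changes neither the volume nor the inclusion in the
    closed box. *)
Lemma itv_cube_on n (c : 'I_n -> R) (l : R) (bl br : 'I_n -> bool) : 0 < l ->
  cube_on (leb R n) (fun i (x : Rn R n) => tnth x i) c l
    [set x : Rn R n | forall i, tnth x i \in
       Interval (BSide (bl i) (c i)) (BSide (br i) (c i + l))].
Proof.
move=> l0; pose B i : set (measurableTypeR R) :=
  [set` Interval (BSide (bl i) (c i)) (BSide (br i) (c i + l))].
have mB i : measurable (B i) by exact: measurable_itv.
rewrite (_ : [set x | _] = [set x | forall i, B i (tnth x i)])//.
have [mQ QE] := leb_borel (measurable_box mB).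
split => //.
- move=> x /= Qx i; move: (Qx i); rewrite /B /= itv_boundlr => /andP[].
  by case: (bl i); case: (br i) => /= ? ?; apply/andP; split => //; exact: ltW.
- rewrite QE borel_lebesgue_box//.
  under eq_bigr => i _.
    rewrite /B lebesgue_measure_itv /= lte_fin ltrDl l0 -EFinB addrAC subrr add0r.
    over.
  by rewrite prodEFin prodr_const card_ord.
Qed.

Lemma cubes_cube_on n (Q : set (Rn R n)) : cubes Q ->
  exists c l, cube_on (leb R n) (fun i (x : Rn R n) => tnth x i) c l Q.
Proof.
by move=> [c [l [bl [br [l0 ->]]]]]; exists c, l; exact: itv_cube_on.
Qed.

Lemma cbox_itvE n (c : 'I_n -> R) (l : R) :
  cbox (fun i (x : Rn R n) => tnth x i) c l =
  [set x : Rn R n | forall i, tnth x i \in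
     Interval (BSide true (c i)) (BSide false (c i + l))].
Proof. by apply/seteqP; split => x /= H i; move: (H i); rewrite in_itv. Qed.

Lemma cbox_cubes n (c : 'I_n -> R) (l : R) : 0 < l ->
  cubes (cbox (fun i (x : Rn R n) => tnth x i) c l).
Proof.
by move=> l0; exists c, l, (fun=> true), (fun=> false); rewrite cbox_itvE.
Qed.

Lemma cbox_cube_on n (c : 'I_n -> R) (l : R) : 0 < l ->
  cube_on (leb R n) (fun i (x : Rn R n) => tnth x i) c l
    (cbox (fun i (x : Rn R n) => tnth x i) c l).
Proof. by move=> l0; rewrite cbox_itvE; exact: itv_cube_on. Qed.

End lebesgue_boxes.

(** * Weak Morrey norms as distribution estimates *)

Section weak_norm.
Context (R : realType) (n : nat).
Implicit Types (F : Rn R n -> \bar R) (p q r K : R).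

Lemma Lnorm_indicI d (T : measurableType d) (mu : {measure set T -> \bar R})
    (D Q : set T) q : 0 < q -> measurable (Q `&` D) ->
  Lnorm mu q%:E (fun x => (EFin \o \1_D) x * (\1_Q x)%:E)%E =
  (mu (Q `&` D) `^ q^-1)%E.
Proof.
move=> q0 mQD; rewrite unlock; congr (_ `^ _)%E.
transitivity (\int[mu]_x (\1_(Q `&` D) x)%:E)%E; last first.
  by rewrite integral_indic// setIT.
apply: eq_integral => x _; rewrite /= !indicE in_setI.
have q_neq0 : q != 0 by rewrite gt_eqF.
case: (x \in D); case: (x \in Q);
  by rewrite /= ?mulr1 ?mulr0 ?normr1 ?normr0 ?powR1 ?powR0.
Qed.

(** A level and a cube must be exhibited, since the supremum of an empty set is [-oo]. *)
Lemma weak_morrey_norm_ge0 p q F : (0 <= weak_morrey_norm p q F)%E.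
Proof.
apply: (@le_trans _ _ (1%:E * morrey_norm p q
    (EFin \o \1_[set x | (1%:E < `|F x|)%E]))%E); last first.
  by apply: ereal_sup_ubound; exists 1 => //=.
rewrite mul1e; pose Q : set (Rn R n) := cbox (fun i (x : Rn R n) => tnth x i) (fun=> 0) 1.
apply: le_trans (ereal_sup_ubound _); last by exists Q => //; exact: cbox_cubes.
by rewrite mule_ge0 ?poweR_ge0// Lnorm_ge0.
Qed.

(** Passes from the two nested suprema to inequalities between reals; [fine] loses nothing because
    cubes have finite measure. *)
Lemma weak_morrey_normP p q F K : 0 < q ->
  (forall r, 0 < r -> measurable [set x | (r%:E < `|F x|)%E]) ->
  (weak_morrey_norm p q F <= K%:E)%E <->
  (forall r Q c l, 0 < r -> cubes Q ->
    cube_on (leb R n) (fun i (x : Rn R n) => tnth x i) c l Q ->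
    r * ((l ^+ n) `^ (p^-1 - q^-1) *
      fine (leb R n (Q `&` [set x | (r%:E < `|F x|)%E])) `^ q^-1) <= K).
Proof.
move=> q0 mF.
have key r Q c l : 0 < r -> cube_on (leb R n) (fun i (x : Rn R n) => tnth x i) c l Q ->
    (leb R n Q `^ (p^-1 - q^-1) * Lnorm (leb R n) q%:E
      (fun x => (EFin \o \1_[set x | (r%:E < `|F x|)%E]) x * (\1_Q x)%:E))%E =
    ((l ^+ n) `^ (p^-1 - q^-1) *
      fine (leb R n (Q `&` [set x | (r%:E < `|F x|)%E])) `^ q^-1)%R%:E.
  move=> r0 cQ; have [l0 mQ _ QE] := cQ.
  have mD := measurableI _ _ mQ (mF _ r0).
  rewrite Lnorm_indicI// QE.
  have fE : leb R n (Q `&` [set x | (r%:E < `|F x|)%E]) \is a fin_num.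
    by rewrite ge0_fin_numE//; exact: cube_sub_fin cQ mD (@subIsetl _ _ _).
  by rewrite -[in LHS](fineK fE).
split.
- move=> H r Q c l r0 Qc cQ; rewrite -lee_fin EFinM -(key _ _ _ _ r0 cQ).
  apply: le_trans H; apply: le_trans (ereal_sup_ubound _); last first.
    by exists r.
  apply: lee_wpmul2l; first by rewrite lee_fin ltW.
  by apply: ereal_sup_ubound; exists Q.
- move=> H; apply: ge_ereal_sup => _ [r /= r0 <-].
  rewrite -lee_pdivlMl//; apply: ge_ereal_sup => _ [Q /= Qc <-].
  have [c [l cQ]] := cubes_cube_on Qc.
  by rewrite (key _ _ _ _ r0 cQ) lee_pdivlMl// -EFinM lee_fin; exact: (H r Q c l).
Qed.

(** The inequality of [weak_morrey_normP] solved for the measure, by raising it to the power [q].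
    This is the shape of [weakA], [weakG] and of the hypothesis in [kolmogorov_constant]. *)
Lemma weak_morrey_norm_distribution p q F K c l r : 0 < q -> 0 <= K ->
  (forall r, 0 < r -> measurable [set x | (r%:E < `|F x|)%E]) ->
  (weak_morrey_norm p q F <= K%:E)%E -> 0 < l -> 0 < r ->
  (leb R n (cbox (fun i (x : Rn R n) => tnth x i) c l `&`
     [set x | (r%:E < `|F x|)%E]) <=
   (K `^ q * (l ^+ n) `^ (1 - q / p) * r `^ (- q))%R%:E)%E.
Proof.
move=> q0 K0 mF FK l0 r0; have cB := cbox_cube_on c l0.
have := (weak_morrey_normP p K q0 mF).1 FK _ _ _ _ r0 (cbox_cubes c l0) cB.
set D := _ `&` _ => H.
have mD : measurable D.
  by apply: measurableI; [have [] := cB|exact: mF].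
have fD : leb R n D \is a fin_num.
  by rewrite ge0_fin_numE//; exact: cube_sub_fin cB mD (@subIsetl _ _ _).
rewrite -(fineK fD) lee_fin; move: H; set m := fine _ => H.
have m0 : 0 <= m by exact: fine_ge0.
have V0 : 0 < l ^+ n by rewrite exprn_gt0.
have {}H : m `^ q^-1 <= K * (l ^+ n) `^ (q^-1 - p^-1) * r^-1.
  rewrite ler_pdivlMr// mulrC.
  have -> : (l ^+ n) `^ (q^-1 - p^-1) = ((l ^+ n) `^ (p^-1 - q^-1))^-1.
    by rewrite -powRN opprB.
  by rewrite ler_pdivlMr ?powR_gt0// mulrAC -mulrA.
have := ge0_ler_powR (ltW q0) (powR_ge0 _ _) _ H.
rewrite -powRrM mulVf ?gt_eqF// powRr1// => /(_ _) le1.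
apply: le_trans (le1 _) _; first by rewrite nnegrE !mulr_ge0 ?powR_ge0 ?invr_ge0// ltW.
rewrite !powRM ?mulr_ge0 ?powR_ge0 ?invr_ge0 ?(ltW r0)//.
have -> : r `^ (- q) = r^-1 `^ q.
  by rewrite -(powR_inv1 (ltW r0)) -powRrM mulN1r.
by rewrite -powRrM mulrBl mulVf ?gt_eqF// (mulrC p^-1).
Qed.

End weak_norm.

(** * Series of complex numbers *)

(** Write [x^v = x * x^(v-1)]: as [v - 1 <= 0], enlarging the base to [x + y] decreases the second
    factor. *)
Lemma powR_subadditive (R : realType) (v x y : R) : 0 < v -> v <= 1 ->
  0 <= x -> 0 <= y -> (x + y) `^ v <= x `^ v + y `^ v.
Proof.
move=> v0 v1 x0 y0; have [->|xN0] := eqVneq x 0.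
  by rewrite powR0 ?gt_eqF// !add0r.
have [->|yN0] := eqVneq y 0; first by rewrite powR0 ?gt_eqF// !addr0.
have xp : 0 < x by rewrite lt0r xN0.
have yp : 0 < y by rewrite lt0r yN0.
have E a : 0 < a -> a `^ v = a * a `^ (v - 1).
  by move=> a0; rewrite mulr_powRB1// ltW.
rewrite (E _ xp) (E _ yp) (E (x + y)) ?addr_gt0// mulrDl lerD//.
  by rewrite ler_wpM2l// ler_powR_neg ?lerDl ?subr_le0.
by rewrite ler_wpM2l// ler_powR_neg ?lerDr ?subr_le0.
Qed.

Lemma powR_sum_le (R : realType) (v : R) (u : nat -> R) (m : nat) :
  0 < v -> v <= 1 -> (forall j, 0 <= u j) ->
  (\sum_(0 <= j < m) u j) `^ v <= \sum_(0 <= j < m) u j `^ v.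
Proof.
move=> v0 v1 u0; elim: m => [|m IH]; first by rewrite !big_nil powR0 ?gt_eqF.
rewrite !big_nat_recr//=; apply: le_trans (powR_subadditive v0 v1 _ (u0 m)) _.
  exact: sumr_ge0.
by rewrite lerD2r.
Qed.

Section complex_series.
Context (R : realType).
Local Notation normc := ComplexField.Normc.normc.

Lemma Re_le_normc (z : R[i]) : `|complex.Re z| <= normc z.
Proof.
by case: z => a b /=; rewrite -sqrtr_sqr ler_wsqrtr// lerDl sqr_ge0.
Qed.

Lemma Im_le_normc (z : R[i]) : `|complex.Im z| <= normc z.
Proof.
by case: z => a b /=; rewrite -sqrtr_sqr ler_wsqrtr// lerDr sqr_ge0.
Qed.

Lemma normc_le_ReIm (z : R[i]) : normc z <= `|complex.Re z| + `|complex.Im z|.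
Proof.
case: z => a b /=; rewrite -[leRHS]ger0_norm ?addr_ge0// -sqrtr_sqr ler_wsqrtr//.
have := mulr_ge0 (normr_ge0 a) (normr_ge0 b).
rewrite sqrrD !real_normK ?num_real//; lra.
Qed.

Lemma cvg_complex (u : nat -> R[i]) (L : R[i]) :
  complex.Re (u m) @[m --> \oo] --> complex.Re L ->
  complex.Im (u m) @[m --> \oo] --> complex.Im L ->
  (u : nat -> R[i]^o) @ \oo --> (L : R[i]^o).
Proof.
move=> /cvgrPdist_lt uR /cvgrPdist_lt uI; apply/cvgrPdist_lt => e e0.
(* The norm of [R[i]] takes values in [R[i]], where [0 < e] says that [e] is real and positive. *)
have [eI eR] : complex.Im e = 0 /\ 0 < complex.Re e.
  by move: e0; rewrite ltcE => /andP[/eqP -> ->].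
have e2 : 0 < complex.Re e / 2 by rewrite divr_gt0.
near=> m.
rewrite normc_def ltcE /= eI eqxx /=.
have h1 : `|complex.Re L - complex.Re (u m)| < complex.Re e / 2 by near: m; exact: uR.
have h2 : `|complex.Im L - complex.Im (u m)| < complex.Re e / 2 by near: m; exact: uI.
have := normc_le_ReIm (L - u m).
move: h1 h2; case: (L) (u m) => [a b] [c d] /= h1 h2 h3.
by apply: (le_lt_trans h3); rewrite (splitr (complex.Re e)) ltrD.
Unshelve. all: by end_near. Qed.

(** Absolute convergence, carried out on real and imaginary parts. Their limits are kept in the
    conclusion because measurability of the sum is checked part by part. *)
Lemma complex_series_cvg (z : nat -> R[i]) (M : R) :
  (forall m, \sum_(0 <= j < m) normc (z j) <= M) ->
  exists L : R[i],
    [/\ (series z : nat -> R[i]^o) @ \oo --> (L : R[i]^o),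
        complex.Re (series z m) @[m --> \oo] --> complex.Re L,
        complex.Im (series z m) @[m --> \oo] --> complex.Im L &
        normc L <= M].
Proof.
move=> zM.
have part (h : R[i] -> R) : (forall w, `|h w| <= normc w) ->
    (forall w1 w2, h (w1 + w2) = h w1 + h w2) -> h 0 = 0 ->
    cvgn (fun m => h (series z m)).
  move=> hle hD h0.
  have -> : (fun m => h (series z m)) = series (fun j => h (z j)).
    by apply/funext => m; rewrite /series /=; elim/big_rec2 : _ => // i x y _ <-.
  apply: (@normed_cvg R R^o (fun j => h (z j))).
  apply: nondecreasing_is_cvgn.
    by apply: nondecreasing_series => j _ _; exact: normr_ge0.
  exists M => _ [m _ <-]; apply: le_trans (zM m).
  by apply: ler_sum => j _; exact: hle.
have [cR cI] : cvgn (fun m => complex.Re (series z m)) /\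
               cvgn (fun m => complex.Im (series z m)).
  split; apply: part => //; 
    [exact: Re_le_normc|by case=> ? ? []|exact: Im_le_normc|by case=> ? ? []].
pose L : R[i] := (limn (fun m => complex.Re (series z m)) +i*
                  limn (fun m => complex.Im (series z m)))%C.
exists L; split => //; first exact: cvg_complex.
have zm m : normc (series z m) <= M.
  apply: le_trans (zM m); rewrite /series /=.
  elim: m => [|m IH]; first by rewrite !big_nil ComplexField.Normc.normc0.
  by rewrite !big_nat_recr//=; apply: le_trans (le_normcD _ _) _; rewrite lerD2r.
apply/ler_addgt0Pr => e e0.
have e2 : 0 < e / 2 by rewrite divr_gt0.
near \oo => m.
have h1 : `|complex.Re L - complex.Re (series z m)| < e / 2.
  by near: m; move/cvgrPdist_lt : cR; apply.
have h2 : `|complex.Im L - complex.Im (series z m)| < e / 2.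
  by near: m; move/cvgrPdist_lt : cI; apply.
rewrite -[L](subrK (series z m)) addrC.
apply: le_trans (le_normcD _ _) _; rewrite lerD//.
apply: le_trans (normc_le_ReIm _) _; rewrite (splitr e).
by rewrite !raddfB /= lerD// ltW.
Unshelve. all: by end_near. Qed.

End complex_series.

Lemma powR_inv_lt (R : realType) (r y v : R) : 0 < v -> 0 <= r -> 0 <= y ->
  r < y `^ v -> r `^ v^-1 < y.
Proof.
move=> v0 r0 y0 ry; have -> : y = (y `^ v) `^ v^-1 by rewrite -powRrM mulfV ?gt_eqF// powRr1.
by rewrite gt0_ltr_powR ?invr_gt0 ?nnegrE ?powR_ge0.
Qed.

Section weighted_series.
Context (R : realType) (v : R) (v0 : 0 < v) (v1 : v <= 1).
Local Notation normc := ComplexField.Normc.normc.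

(** Here [v <= 1] acts: by subadditivity of the power [v], the partial sums of the moduli are at
    most [H^(1/v)], which gives both absolute convergence and the bound on the limit. *)
Lemma weighted_series_cvg (lam : nat -> R) (z : nat -> R[i]) :
  (forall j, 0 <= lam j) ->
  let H := (\sum_(j <oo) (lam j `^ v * normc (z j) `^ v)%R%:E)%E in
  let S : nat -> R[i]^o := series (fun j => (lam j)%:C%C * z j) in
  (H < +oo)%E ->
  [/\ cvgn S, complex.Re (S m) @[m --> \oo] --> complex.Re (limn S),
      complex.Im (S m) @[m --> \oo] --> complex.Im (limn S) &
      normc (limn S) `^ v <= fine H].
Proof.
move=> lam0 H S Hfin.
have t0 j : (0 <= (lam j `^ v * normc (z j) `^ v)%R%:E)%E.
  by rewrite lee_fin mulr_ge0 ?powR_ge0.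
have H0 : (0 <= H)%E by exact: nneseries_ge0.
have fH : H \is a fin_num by rewrite ge0_fin_numE.
have nz j : normc ((lam j)%:C%C * z j) = lam j * normc (z j).
  rewrite ComplexField.Normc.normcM; congr (_ * _).
  by rewrite /= expr0n addr0 sqrtr_sqr ger0_norm.
have nc0 (w : R[i]) : 0 <= normc w by case: w => ? ?; exact: sqrtr_ge0.
have [L [SL SR SI LM]] : exists L : R[i], [/\ S @ \oo --> (L : R[i]^o),
    complex.Re (S m) @[m --> \oo] --> complex.Re L,
    complex.Im (S m) @[m --> \oo] --> complex.Im L &
    normc L <= fine H `^ v^-1].
  apply: complex_series_cvg => m.
  under eq_bigr do rewrite nz.
  set u := \sum_(0 <= j < m) _.
  have u0 : 0 <= u by apply: sumr_ge0 => j _; rewrite mulr_ge0.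
  have : u `^ v <= fine H.
    apply: le_trans (powR_sum_le _ v0 v1 _) _; first by move=> j; rewrite mulr_ge0.
    rewrite -lee_fin fineK// -sumEFin.
    under eq_bigr do rewrite powRM//.
    exact: nneseries_lim_ge.
  move=> /(ge0_ler_powR (ltW (_ : 0 < v^-1))) => /(_ _ _ _).
  rewrite -powRrM mulfV ?gt_eqF// powRr1//; apply; rewrite ?nnegrE ?powR_ge0 ?fine_ge0//.
  by rewrite invr_gt0.
have SE : limn S = L by apply: (@cvg_lim R[i]^o); first exact: norm_hausdorff.
rewrite SE; split => //.
have := ge0_ler_powR (ltW v0) (nc0 L) (powR_ge0 _ _) LM.
by rewrite -powRrM mulVf ?gt_eqF// powRr1// fine_ge0.
Qed.

End weighted_series.

Lemma measurable_normc d (T : measurableType d) (R : realType) (f : T -> R[i]) D :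
  measurable_fun D (fun x => complex.Re (f x)) ->
  measurable_fun D (fun x => complex.Im (f x)) ->
  measurable_fun D (fun x => ComplexField.Normc.normc (f x)).
Proof.
move=> mR mI.
have -> : (fun x => ComplexField.Normc.normc (f x)) =
    (fun x => Num.sqrt (complex.Re (f x) ^+ 2 + complex.Im (f x) ^+ 2)).
  by apply/funext => x; case: (f x).
apply: (measurableT_comp (f := @Num.sqrt R)).
  by apply: continuous_measurable_fun; exact: sqrt_continuous.
by apply: measurable_funD; exact: measurable_funX.
Qed.

(** * From integral estimates to weak Morrey norms *)

Lemma measurable_abs_superlevel d (T : measurableType d) (R : realType)
    (F : T -> \bar R) (r : R) :
  measurable_fun setT F -> measurable [set x | (r%:E < `|F x|)%E].
Proof.
move=> mF; rewrite -[X in measurable X]setTI.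
apply: emeasurable_fun_o_infty; first exact: measurableT.
exact: (measurableT_comp (@abse_measurable R setT) mF).
Qed.

Lemma measurable_complex_series d (T : measurableType d) (R : realType)
    (lam : nat -> R) (a : nat -> T -> R[i]) (m : nat) :
  (forall j, measurable_fun setT (fun x => complex.Re (a j x))) ->
  (forall j, measurable_fun setT (fun x => complex.Im (a j x))) ->
  let S x := series (fun j => (lam j)%:C%C * a j x) m in
  measurable_fun setT (fun x => complex.Re (S x)) /\
  measurable_fun setT (fun x => complex.Im (S x)).
Proof.
move=> mR mI S.
have SE (h : R[i] -> R) : (forall w1 w2, h (w1 + w2) = h w1 + h w2) -> h 0 = 0 ->
    (fun x => h (S x)) = (fun x => \sum_(0 <= j < m) h ((lam j)%:C%C * a j x)).
  move=> hD h0; apply/funext => x; rewrite /S /series /=.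
  by elim/big_rec2 : _ => // i y z _ <-.
split; rewrite SE//; try by case=> ? ? [].
- apply: measurable_sum => j.
  have -> : (fun x => complex.Re ((lam j)%:C%C * a j x)) =
      (fun x => lam j * complex.Re (a j x)).
    by apply/funext => x; case: (a j x) => ? ? /=; rewrite mul0r subr0.
  exact: measurable_funM.
- apply: measurable_sum => j.
  have -> : (fun x => complex.Im ((lam j)%:C%C * a j x)) =
      (fun x => lam j * complex.Im (a j x)).
    by apply/funext => x; case: (a j x) => ? ? /=; rewrite mul0r addr0.
  exact: measurable_funM.
Qed.

Section assembly.
Context (R : realType) (n : nat) (p q s t v : R).
Context (n0 : (0 < n)%N) (q0 : 0 < q) (qp : q <= p) (t0 : 0 < t) (ts : t <= s).
Context (v0 : 0 < v) (v1 : v <= 1) (ps : p < s) (vq : v < q) (qt : q < t).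
Local Notation normc := ComplexField.Normc.normc.
Local Notation X := (fun (i : 'I_n) (x : Rn R n) => tnth x i).

Context (Cq Ct : R) (Cq0 : 0 < Cq) (Ct0 : 0 < Ct).
Context (HCq : kolmogorov_constant (leb R n) (q / v) Cq).
Context (HCt : kolmogorov_constant (leb R n) (t / v) Ct).

Context (Q : nat -> set (Rn R n)) (a : nat -> Rn R n -> R[i]) (lam : nat -> R).

Definition majorant (x : Rn R n) : \bar R :=
  ((\sum_(j <oo) ((lam j * \1_(Q j) x) `^ v)%:E) `^ v^-1)%E.
Definition series_of (x : Rn R n) : nat -> R[i]^o :=
  series (fun j => (lam j)%:C%C * a j x).
Definition sum_of (x : Rn R n) : R[i] := limn (series_of x).

Context (Qcubes : forall j, cubes (Q j)) (aL0 : forall j, L0 (a j)).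
Context (lam0 : forall j, 0 <= lam j).
Context (a_norm : forall j, (weak_morrey_norm s t (modulus (a j)) <=
  leb R n (Q j) `^ s^-1)%E).
Context (a_supp : forall j, supp (a j) `<=` Q j).

(** The series of the abstract estimate, with weights [lam j ^ v] and atoms [|a j|^v]. *)
Let H (x : Rn R n) : \bar R :=
  (\sum_(j <oo) (lam j `^ v * normc (a j x) `^ v)%R%:E)%E.

Let nc0 (z : R[i]) : 0 <= normc z.
Proof. by case: z => ? ?; exact: sqrtr_ge0. Qed.

Let ma j : measurable_fun setT (fun x => normc (a j x)).
Proof. by have [] := aL0 j; exact: measurable_normc. Qed.

Let mav j : measurable_fun setT (fun x => normc (a j x) `^ v).
Proof. exact: (measurableT_comp (measurable_powR v)). Qed.

Let mQ j : measurable (Q j).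
Proof. by have [c [l []]] := cubes_cube_on (Qcubes j). Qed.

Let mmod j : measurable_fun setT (modulus (a j)).
Proof. exact/measurable_EFinP. Qed.

Let mmaj : measurable_fun setT majorant.
Proof.
apply: (measurableT_comp (measurable_poweR v^-1)).
apply: ge0_emeasurable_sum.
  by move=> j x _ _; rewrite lee_fin powR_ge0.
move=> j _; apply/measurable_EFinP.
apply: (measurableT_comp (measurable_powR v)).
by apply: measurable_funM => //; exact: measurable_indic.
Qed.

(** Being above [r] for [|a j|^v] is being above [r^(1/v)] for [|a j|], so the weak bound with
    exponents [(s, t)] becomes one with exponents [(s/v, t/v)]. *)
Lemma atom_distribution c_ l_ j c l P r :
  cube_on (leb R n) X c_ l_ (Q j) -> cube_on (leb R n) X c l P -> 0 < r ->
  (leb R n (P `&` [set x | (r < normc (a j x) `^ v)%R]) <=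
   ((l_ ^+ n) `^ (t / v / (s / v)) * (l ^+ n) `^ (1 - t / v / (s / v)) *
    r `^ (- (t / v)))%R%:E)%E.
Proof.
move=> cj [l0 mP Pc _] r0; have [lj0 _ _ Qj] := cj.
have s0 : 0 < s by exact: lt_le_trans ts.
have -> : t / v / (s / v) = t / s by field; rewrite !gt_eqF.
have rv0 : 0 < r `^ v^-1 by rewrite powR_gt0.
have aK : (weak_morrey_norm s t (modulus (a j)) <= ((l_ ^+ n) `^ s^-1)%:E)%E.
  by rewrite -poweR_EFin -Qj.
have := weak_morrey_norm_distribution c t0 (powR_ge0 _ _)
  (fun r _ => measurable_abs_superlevel r (mmod j)) aK l0 rv0.
have -> : ((l_ ^+ n) `^ s^-1) `^ t = (l_ ^+ n) `^ (t / s) by rewrite -powRrM mulrC.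
have -> : (r `^ v^-1) `^ (- t) = r `^ (- (t / v)) by rewrite -powRrM mulrN mulrC.
apply: le_trans; apply: le_measure; rewrite ?inE.
- by apply: measurableI => //; exact: measurable_superlevel.
- apply: measurableI; last exact: measurable_abs_superlevel.
  by have [] := cbox_cube_on c l0.
- move=> x [/Pc cx /= rx]; split => //=.
  by rewrite /modulus lte_fin ger0_norm// powR_inv_lt// ltW.
Qed.

(** The same rescaling for the majorant, with [K^v] in the role of [N]. Partial sums suffice for
    [weakG], and they lie below the full series. *)
Lemma majorant_distribution K m c l r : 0 < K ->
  (weak_morrey_norm p q majorant <= K%:E)%E -> 0 < l -> 0 < r ->
  (leb R n (cbox X c l `&`
     [set x | (r < \sum_(0 <= j < m) lam j `^ v * \1_(Q j) x)%R]) <=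
   ((K `^ v) `^ (q / v) * (l ^+ n) `^ (1 - q / v / (p / v)) *
    r `^ (- (q / v)))%R%:E)%E.
Proof.
move=> K0 gK l0 r0.
have p0 : 0 < p by exact: lt_le_trans qp.
have -> : q / v / (p / v) = q / p by field; rewrite !gt_eqF.
have rv0 : 0 < r `^ v^-1 by rewrite powR_gt0.
have := weak_morrey_norm_distribution c q0 (ltW K0)
  (fun r _ => measurable_abs_superlevel r mmaj) gK l0 rv0.
have -> : (K `^ v) `^ (q / v) = K `^ q by rewrite -powRrM mulrCA mulfV ?mulr1// gt_eqF.
have -> : (r `^ v^-1) `^ (- q) = r `^ (- (q / v)) by rewrite -powRrM mulrN mulrC.
apply: le_trans; apply: le_measure; rewrite ?inE.
- apply: measurableI; first by have [] := cbox_cube_on c l0.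
  apply: measurable_superlevel; apply: measurable_sum => j.
  by apply: measurable_funM => //; exact: measurable_indic.
- apply: measurableI; last exact: measurable_abs_superlevel.
  by have [] := cbox_cube_on c l0.
- move=> x [cx /= rx]; split => //=.
  have S0 j : (0 <= ((lam j * \1_(Q j) x) `^ v)%:E)%E by rewrite lee_fin powR_ge0.
  rewrite gee0_abs ?poweR_ge0// /majorant.
  have : (r%:E < \sum_(j <oo) ((lam j * \1_(Q j) x) `^ v)%:E)%E.
    apply: (@lt_le_trans _ _ (\sum_(0 <= j < m) ((lam j * \1_(Q j) x) `^ v)%:E)%E).
      rewrite sumEFin lte_fin; apply: (lt_le_trans rx); apply: ler_sum => j _.
      rewrite powRM// ?indicE// ler_wpM2l ?powR_ge0//.
      by case: (x \in Q j); rewrite ?powR1// powR0 ?gt_eqF.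
    exact: nneseries_lim_ge.
  case: (\sum_(j <oo) _)%E => [y| |//]; last first.
    by move=> _; rewrite poweRyr ?ltry// gt_eqF// invr_gt0.
  rewrite lte_fin => ry; rewrite poweR_EFin lte_fin.
  by rewrite gt0_ltr_powR ?invr_gt0// nnegrE ltW// (lt_trans r0).
Qed.

Let C := small_cst n (p / v) (q / v) (t / v) Cq Ct +
         large_cst n (p / v) (s / v) Cq Ct.

Let q1 : 1 < q / v. Proof. by rewrite ltr_pdivlMr// mul1r. Qed.
Let qp1 : q / v <= p / v. Proof. by rewrite ler_pM2r// invr_gt0. Qed.
Let qt1 : q / v < t / v. Proof. by rewrite ltr_pM2r// invr_gt0. Qed.
Let ts1 : t / v <= s / v. Proof. by rewrite ler_pM2r// invr_gt0. Qed.
Let ps1 : p / v < s / v. Proof. by rewrite ltr_pM2r// invr_gt0. Qed.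

Let cube_data : exists c_ l_, forall j,
  cube_on (leb R n) X (c_ j) (l_ j) (Q j).
Proof.
have /choice[c_ /choice[l_ cQ]] := fun j => cubes_cube_on (Qcubes j).
by exists c_, l_.
Qed.

Let supp_normc j x : normc (a j x) `^ v != 0 -> Q j x.
Proof.
move=> ax; apply: a_supp; apply: subset_closure; exists x => //=.
apply: contra ax => /eqP ->.
by rewrite ComplexField.Normc.normc0 powR0// gt_eqF.
Qed.

Let superlevel_H K c l P r : 0 < K ->
  (weak_morrey_norm p q majorant <= K%:E)%E ->
  cube_on (leb R n) X c l P -> 0 < r ->
  r * fine (leb R n (P `&` [set x | (r%:E < H x)%E])) `^ (q / v)^-1 <=
  C * K `^ v * (l ^+ n) `^ ((q / v)^-1 - (p / v)^-1).
Proof.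
move=> K0 gK cP r0; have [c_ [l_ cQ]] := cube_data.
exact: (superlevel_series_le (@cbox_cube_on R n) q1 qp1 qt1 ts1
  (powR_gt0 v K0) Cq0 HCq Ct0 HCt cQ (fun j => powR_ge0 _ _)
  (fun j x => powR_ge0 _ _) mav supp_normc
  (fun j c l P r => atom_distribution (cQ j))
  (fun m c l r => majorant_distribution m c K0 gK) n0 ps1 cP r0).
Qed.

Let mH : measurable_fun setT H.
Proof.
apply: ge0_emeasurable_sum => [j x _ _|j _].
  by rewrite lee_fin mulr_ge0 ?powR_ge0.
by apply/measurable_EFinP; apply: measurable_funM.
Qed.

Let H_fin_ae : (weak_morrey_norm p q majorant < +oo)%E ->
  (leb R n).-negligible [set x | H x = +oo%E].
Proof.
move=> gfin.
have [K K0 gK] : exists2 K, 0 < K & (weak_morrey_norm p q majorant <= K%:E)%E.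
  (* The estimates ask for a positive bound, while the norm itself may vanish. *)
  exists (fine (weak_morrey_norm p q majorant) + 1).
    by rewrite ltr_wpDl// fine_ge0// weak_morrey_norm_ge0.
  rewrite -[leLHS]fineK ?ge0_fin_numE ?weak_morrey_norm_ge0//.
  by rewrite lee_fin lerDl.
have [c_ [l_ cQ]] := cube_data.
pose B (k : nat) := cbox X (fun=> - k.+1%:R) (2 * k.+1%:R).
have B0 (k : nat) : cube_on (leb R n) X (fun=> - k.+1%:R) (2 * k.+1%:R) (B k).
  by apply: cbox_cube_on; rewrite mulr_gt0.
rewrite (_ : [set x | _] = \bigcup_k (B k `&` [set x | H x = +oo%E])); last first.
  apply/seteqP; split => [x Hx|x [k _ []]//].
  pose M := \sum_(i < n) `|tnth x i|.
  exists (Num.bound M) => //; split => // i.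
  have Mk : `|tnth x i| <= (Num.bound M).+1%:R.
    apply: (@le_trans _ _ M); last first.
      by rewrite (le_trans (ltW (archi_boundP _)))// ?ler_nat// sumr_ge0.
    by rewrite /M (bigD1 i)//= lerDl sumr_ge0.
  by move: Mk; rewrite ler_norml => /andP[? ?]; apply/andP; split; lra.
apply: negligible_bigcup => k.
exists (B k `&` [set x | H x = +oo%E]); split => //.
  have [_ mBk _ _] := B0 k.
  exact: (measurableI _ _ mBk (measurable_eq_pinfty mH)).
exact: (ae_series_fin (@cbox_cube_on R n) q1 qp1 qt1 ts1
    (powR_gt0 v K0) Cq0 HCq Ct0 HCt cQ (fun j => powR_ge0 _ _)
    (fun j x => powR_ge0 _ _) mav supp_normc
    (fun j c l P r => atom_distribution (cQ j))
    (fun m c l r => majorant_distribution m c K0 gK) n0 ps1 (B0 k)).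
Qed.

Lemma majorant_ae_cvg : (weak_morrey_norm p q majorant < +oo)%E ->
  {ae leb R n, forall x, cvgn (series_of x)}.
Proof.
move=> gfin; apply: negligibleS (H_fin_ae gfin) => x /= ncvg.
apply: contrapT => Hx; apply: ncvg.
have [] // := weighted_series_cvg v0 v1 (z := fun j => a j x) lam0 _.
by rewrite ltey; apply/eqP.
Qed.

(** Off the null set where [H] is infinite, the sum is a pointwise limit of measurable functions. On
    that set its values are arbitrary, and completeness of the Lebesgue sigma-algebra makes any
    function measurable there. *)
Lemma sum_of_L0 : (weak_morrey_norm p q majorant < +oo)%E -> L0 sum_of.
Proof.
move=> gfin; set B := [set x | H x = +oo%E].
have mB : measurable B := measurable_eq_pinfty mH.
have B0 : leb R n B = 0%E by apply/negligibleP => //; exact: H_fin_ae.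
have key (h : Rn R n -> R) (u : nat -> Rn R n -> R) :
    (forall m, measurable_fun setT (u m)) ->
    (forall x, ~ B x -> u m x @[m --> \oo] --> h x) -> measurable_fun setT h.
  move=> mu uh; rewrite -(setvU B); apply/measurable_funU => //.
    exact: measurableC.
  split.
    apply: measurable_fun_cvg => [m|x Bx]; last exact: uh.
    exact: measurable_funTS.
  move=> _ Y _; apply: measure_is_complete_caratheodory.
  by exists B; split => // x [].
have HB x : ~ B x -> (H x < +oo)%E by move=> ?; rewrite ltey; apply/eqP.
have mS m := measurable_complex_series lam m (fun j => (aL0 j).1) (fun j => (aL0 j).2).
split.
- apply: (key _ (fun m x => complex.Re (series_of x m))) => [m|x /HB Hx].
    exact: (mS m).1.
  by have [] := weighted_series_cvg v0 v1 (z := fun j => a j x) lam0 Hx.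
- apply: (key _ (fun m x => complex.Im (series_of x m))) => [m|x /HB Hx].
    exact: (mS m).2.
  by have [] := weighted_series_cvg v0 v1 (z := fun j => a j x) lam0 Hx.
Qed.

(** The set where [|f| > r] lies in the one where [H > r^v], to which [superlevel_H] applies; taking
    the power [1/v] restores the original exponents. *)
Lemma sum_of_norm_le K : 0 < K -> (weak_morrey_norm p q majorant <= K%:E)%E ->
  (weak_morrey_norm p q (modulus sum_of) <= (C `^ v^-1 * K)%:E)%E.
Proof.
move=> K0 gK.
have [mR mI] := sum_of_L0 (le_lt_trans gK (ltry K)).
have mf : measurable_fun setT (modulus sum_of).
  by apply/measurable_EFinP; exact: measurable_normc.
apply/(weak_morrey_normP _ _ q0) => [r _|r P c l r0 _ cP].
  exact: measurable_abs_superlevel.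
have [l0 mP _ _] := cP.
have V0 : 0 < l ^+ n by rewrite exprn_gt0.
have rv0 : 0 < r `^ v by rewrite powR_gt0.
have p0 : 0 < p by exact: lt_le_trans qp.
have C0 : 0 <= C.
  by rewrite addr_ge0// ltW ?small_cst_gt0// (@large_cst_gt0 _ n (p / v) (q / v) (s / v) (t / v)).
set D := P `&` _; set D' := P `&` [set x | ((r `^ v)%:E < H x)%E].
have mD : measurable D by apply: measurableI => //; exact: measurable_abs_superlevel.
have mD' : measurable D'.
  by rewrite /D'; apply: emeasurable_fun_o_infty => //; exact: measurable_funTS.
have DD' : D `<=` D'.
  move=> x [Px /= rx]; split => //=.
  (* Where the series of moduli diverges, [sum_of] takes a junk value, but such
     points belong to every superlevel set of [H]. *)
  have [->|Hx] := eqVneq (H x) +oo%E; first exact: ltry.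
  have {}Hx : (H x < +oo)%E by rewrite ltey.
  have [_ _ _ le] := weighted_series_cvg v0 v1 (z := fun j => a j x) lam0 Hx.
  have H0 : (0 <= H x)%E.
    by apply: nneseries_ge0 => j _ _; rewrite lee_fin mulr_ge0 ?powR_ge0.
  rewrite -(fineK (_ : H x \is a fin_num)) ?ge0_fin_numE// lte_fin.
  apply: lt_le_trans le; move: rx; rewrite /modulus lte_fin ger0_norm// => rx.
  by rewrite gt0_ltr_powR ?nnegrE ?nc0 ?(ltW r0).
have finD E : measurable E -> E `<=` P -> leb R n E \is a fin_num.
  by move=> mE EP; rewrite ge0_fin_numE//; exact: cube_sub_fin cP mE EP.
have fD := finD D mD (@subIsetl _ _ _); have fD' := finD D' mD' (@subIsetl _ _ _).
have le1 : fine (leb R n D) `^ q^-1 <= fine (leb R n D') `^ q^-1.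
  rewrite ge0_ler_powR ?nnegrE ?fine_ge0// ?invr_ge0 ?(ltW q0)//.
  by rewrite fine_le//; apply: le_measure; rewrite ?inE.
have := superlevel_H K0 gK cP rv0; rewrite -/D'.
set m' := fine (leb R n D') in le1 *; set V := l ^+ n in V0 *.
have vV0 : 0 <= v^-1 by rewrite invr_ge0 ltW.
move=> /(ge0_ler_powR vV0) => /(_ _ _).
rewrite !nnegrE !mulr_ge0 ?powR_ge0// => /(_ isT isT).
rewrite !powRM ?mulr_ge0 ?powR_ge0// -!powRrM mulfV ?gt_eqF//.
rewrite !powRr1 ?(ltW r0) ?(ltW K0)//.
have -> : (q / v)^-1 / v = q^-1 by field; rewrite !gt_eqF.
have -> : ((q / v)^-1 - (p / v)^-1) / v = q^-1 - p^-1 by field; rewrite !gt_eqF.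
move=> le2.
rewrite mulrCA -ler_pdivlMl ?powR_gt0// -powRN opprB.
apply: (@le_trans _ _ (r * m' `^ q^-1)); first by rewrite ler_wpM2l// ltW.
by rewrite [leRHS]mulrC.
Qed.

End assembly.

Theorem corollary1p3 (R : realType) (n : nat) (p q s t v : R) :
  (0 < n)%N ->
  0 < q -> q <= p ->
  0 < t -> t <= s ->
  0 < v -> v <= 1 ->
  p < s ->
  v < q -> q < t ->
  exists2 C : R, 0 < C &
  forall (Q : nat -> set (Rn R n)) (a : nat -> Rn R n -> R[i])
         (lam : nat -> R),
    let g (x : Rn R n) : \bar R :=
      ((\sum_(j <oo) ((lam j * \1_(Q j) x) `^ v)%:E) `^ v^-1)%E in
    let sums (x : Rn R n) : nat -> R[i]^o :=
      series (fun j => (lam j)%:C%C * a j x) in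
    let f (x : Rn R n) : R[i] := limn (sums x) in
    (forall j, cubes (Q j)) ->
    (forall j, weak_morrey s t (a j)) ->
    (forall j, 0 <= lam j) ->
    (forall j, (weak_morrey_norm s t (modulus (a j))
                  <= leb R n (Q j) `^ s^-1)%E) ->
    (forall j, supp (a j) `<=` Q j) ->
    (weak_morrey_norm p q g < +oo)%E ->
    {ae leb R n, forall x, cvgn (sums x)} /\
    L0 f /\
    (weak_morrey_norm p q (modulus f) <= C%:E * weak_morrey_norm p q g)%E.
Proof.
move=> n0 q0 qp t0 ts v0 v1 ps vq qt.
have q1 : 1 < q / v by rewrite ltr_pdivlMr// mul1r.
have vt : v < t by exact: lt_trans qt.
have t1 : 1 < t / v by rewrite ltr_pdivlMr// mul1r.
have [Cq Cq0 HCq] := kolmogorov (leb R n) q1.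
have [Ct Ct0 HCt] := kolmogorov (leb R n) t1.
have Cs0 : 0 < small_cst n (p / v) (q / v) (t / v) Cq Ct.
  by apply: small_cst_gt0; rewrite ?ltr_pM2r ?invr_gt0.
have Cl0 : 0 < large_cst n (p / v) (s / v) Cq Ct.
  by apply: (@large_cst_gt0 _ n _ (q / v) _ (t / v));
    rewrite ?ltr_pM2r ?ler_pM2r ?invr_gt0.
(* Fixed before the cubes, atoms and coefficients are introduced; the power [1/v] undoes the passage
   to [v]-th powers. *)
exists ((small_cst n (p / v) (q / v) (t / v) Cq Ct +
         large_cst n (p / v) (s / v) Cq Ct) `^ v^-1).
  by rewrite powR_gt0// addr_gt0.
set C := _ `^ v^-1; have C0 : 0 < C by rewrite powR_gt0// addr_gt0.
move=> Q a lam g sums f Qc aW lam0 a_norm a_supp gfin.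
have aL0 j : L0 (a j) := (aW j).1.
split; first exact: (majorant_ae_cvg n0 q0 qp t0 ts v0 v1 ps vq qt
  Cq0 Ct0 HCq HCt Qc aL0 lam0 a_norm a_supp gfin).
split; first exact: (sum_of_L0 n0 q0 qp t0 ts v0 v1 ps vq qt
  Cq0 Ct0 HCq HCt Qc aL0 lam0 a_norm a_supp gfin).
have fg : weak_morrey_norm p q g \is a fin_num.
  by rewrite ge0_fin_numE// weak_morrey_norm_ge0.
(* A slack [e] is needed because [sum_of_norm_le] wants a positive [K] and the norm of [g] may be
   [0]; [e / C] becomes [e] after multiplication by [C]. *)
apply/lee_addgt0Pr => e e0; rewrite -(fineK fg) -EFinM -EFinD.
have K0 : 0 < fine (weak_morrey_norm p q g) + e / C.
  by rewrite ltr_wpDl ?fine_ge0 ?weak_morrey_norm_ge0// divr_gt0.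
have -> : C * fine (weak_morrey_norm p q g) + e =
    C * (fine (weak_morrey_norm p q g) + e / C).
  by rewrite mulrDr mulrCA mulfV ?mulr1// gt_eqF.
apply: (sum_of_norm_le n0 q0 qp t0 ts v0 v1 ps vq qt
  Cq0 Ct0 HCq HCt Qc aL0 lam0 a_norm a_supp K0).
by rewrite -[leLHS](fineK fg) lee_fin lerDl divr_ge0// ltW.
Qed.
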